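(* Let $\mu>0$, let $\mathbb{G}_0\stackrel{(law)}{=}\frac{1}{1+\exp(\pi C)}$ where $C$ is a standard Cauchy variable, and let $(\Gamma_t(\mu+\mathbb{G}_0),\,t\ge0)$ be the subordinator characterized by $$E(e^{-\lambda\Gamma_t(\mu+\mathbb{G}_0)})=\exp\left\{-t\int_0^\infty(1-e^{-\lambda x})\frac{dx}{x}E(e^{-x(\mu+\mathbb{G}_0)})\right\}\qquad(\lambda,t\ge0).$$ Then: 1. (Laplace transform) For $\lambda,t\ge0$, $$E(e^{-\lambda\Gamma_t(\mu+\mathbb{G}_0)})=\left(\frac{\log\left(1+\frac{1}{\lambda+\mu}\right)}{\log\left(1+\frac1\mu\right)}\right)^t .$$ 2. (Laws) The densities of $\Gamma_1(\mu+\mathbb{G}_0)$ and $D_1(\mu+\mathbb{G}_0)$ equal $$f_{\Gamma_1(\mu+\mathbb{G}_0)}(x)=\frac{1}{\log\left(1+\frac1\mu\right)}\,e^{-\mu x}\,\frac{1-e^{-x}}{x}\,1_{[0,\infty[}(x),\qquad f_{D_1(\mu+\mathbb{G}_0)}(x)=\frac{1}{\log\left(1+\frac1\mu\right)}\,\frac1x\,1_{\left[\frac{1}{\mu+1},\frac1\mu\right]}(x).$$ 3. (Wiener-Gamma representation) For every $t>0$, $$\Gamma_t(\mu+\mathbb{G}_0)\stackrel{(law)}{=}\int_0^t\frac{1+\exp\left(\pi\cot\left(\frac{\pi u}{t}\right)\right)}{1+\mu\left(1+\exp\left(\pi\cot\left(\frac{\pi u}{t}\right)\right)\right)}\,d\gamma_u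 .$$
   Context: $(\gamma_t,\,t\ge0)$ is the standard gamma process, i.e. the subordinator without drift and with Lévy measure $\frac{dx}{x}e^{-x}$, $x>0$. For fixed $t>0$, $\gamma_t$ is a gamma variable with density $e^{-a}a^{t-1}/\Gamma(t)$ on $(0,\infty)$. Integrals $\int_0^th(u)\,d\gamma_u$ with $h\ge0$ are pathwise Stieltjes integrals. $D_1(\mu+\mathbb{G}_0)$ is the random variable whose law is characterized by $\Gamma_1(\mu+\mathbb{G}_0)\stackrel{(law)}{=}\gamma_1\cdot D_1(\mu+\mathbb{G}_0)$, with $\gamma_1$ a standard exponential variable independent of $D_1(\mu+\mathbb{G}_0)$. *)

(* Defs.v *)
From HB Require Import structures.
From mathcomp Require Import all_boot all_order all_algebra.
From mathcomp Require Import all_classical all_reals all_analysis.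
From mathcomp Require Import measurable_realfun.

Set Implicit Arguments.
Unset Strict Implicit.
Unset Printing Implicit Defensive.

Import Order.TTheory GRing.Theory Num.Theory.
Import numFieldNormedType.Exports.

Local Open Scope classical_set_scope.
Local Open Scope ring_scope.
Local Open Scope ereal_scope.

(* [cot] takes the junk value 0 at the multiples of [pi]. *)
Definition cot {R : realType} (x : R) : R := (cos x / sin x)%R.

(* The two variables may live on different probability spaces. Measurability
   is part of the definition, since [P] only has meaning on measurable sets. *)
Definition same_law {R : realType} {d1 d2 d : measure_display}
    {T1 : measurableType d1} {T2 : measurableType d2} {S : measurableType d}
    (P1 : probability T1 R) (X1 : T1 -> S)
    (P2 : probability T2 R) (X2 : T2 -> S) : Prop :=
  [/\ measurable_fun setT X1, measurable_fun setT X2 &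
      forall A : set S, measurable A -> P1 (X1 @^-1` A) = P2 (X2 @^-1` A)].

Definition has_density {R : realType} {d : measure_display}
    {T : measurableType d} (P : probability T R) (X : {RV P >-> R})
    (f : R -> R) : Prop :=
  forall A : set R, measurable A ->
    distribution P X A = \int[lebesgue_measure]_(x in A) (f x)%:E.

Definition cauchy_pdf {R : realType} (x : R) : R :=
  (pi * (1 + x ^+ 2))^-1%R.

(* Mutual independence of a finite family. Taking some [B i] to be [setT]
   yields the product rule for every subfamily. *)
Definition mutually_independent {R : realType} {d : measure_display}
    {T : measurableType d} (P : probability T R) (n : nat)
    (X : 'I_n -> T -> R) : Prop :=
  forall B : 'I_n -> set R, (forall i, measurable (B i)) ->
    P (\bigcap_(i in [set: 'I_n]) (X i @^-1` B i)) =
    \prod_(i < n) P (X i @^-1` B i).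

Definition independent {R : realType} {d : measure_display}
    {T : measurableType d} (P : probability T R) (X Y : T -> R) : Prop :=
  forall A B : set R, measurable A -> measurable B ->
    P (X @^-1` A `&` Y @^-1` B) = P (X @^-1` A) * P (Y @^-1` B).

(* The time set is [0, +oo[: the values at negative indices are unconstrained
   and are never used. *)
Record subordinator {R : realType} {d : measure_display}
    {T : measurableType d} (P : probability T R) := Subordinator {
  sub_fun :> R -> {RV P >-> R} ;
  sub_start : forall w, sub_fun 0%R w = 0%R ;
  sub_nondecreasing : forall w s t, (0 <= s)%R -> (s <= t)%R ->
    (sub_fun s w <= sub_fun t w)%R ;
  sub_right_continuous : forall w t, (0 <= t)%R ->
    sub_fun s w @[s --> t^'+] --> sub_fun t w ;
  sub_independent_increments : forall (n : nat) (t : nat -> R),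
    (0 <= t 0%N)%R -> (forall i, (i < n)%N -> (t i <= t i.+1)%R) ->
    mutually_independent P
      (fun (i : 'I_n) w => (sub_fun (t i.+1) w - sub_fun (t i) w)%R) ;
  sub_stationary_increments : forall s t, (0 <= s)%R -> (0 <= t)%R ->
    same_law P (fun w => (sub_fun (s + t) w - sub_fun s w)%R)
             P (sub_fun t) }.

(* Levy-Khintchine formula: [X] is driftless with Levy measure [g x dx] on
   ]0, +oo[. *)
Definition has_levy_density {R : realType} {d : measure_display}
    {T : measurableType d} (P : probability T R) (X : subordinator P)
    (g : R -> \bar R) : Prop :=
  forall lambda t : R, (0 <= lambda)%R -> (0 <= t)%R ->
    'E_P[fun w => expR (- lambda * X t w)%R] =
    expeR (- (t%:E * \int[lebesgue_measure]_(x in `]0%R, +oo[)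
                       ((1 - expR (- lambda * x))%:E * g x))).

Definition standard_gamma_process {R : realType} {d : measure_display}
    {T : measurableType d} (P : probability T R) (X : subordinator P) : Prop :=
  has_levy_density X (fun x => (x^-1 * expR (- x))%:E).

Section stieltjes.
Context {R : realType} {d : measure_display} {T : measurableType d}.
Variables (P : probability T R) (X : subordinator P).

(* Constant extension of a path to negative times, as
   [lebesgue_stieltjes_measure] wants a function on all of [R]. *)
Definition sub_path (w : T) (u : R) : R := X (Num.max 0 u)%R w.

Lemma sub_path_nondecreasing (w : T) : {homo sub_path w : x y / (x <= y)%R}.
Proof.
move=> x y xy; apply: sub_nondecreasing; first by rewrite le_max lexx.
by rewrite ge_max !le_max lexx/= xy orbT.
Qed.

Lemma sub_path_right_continuous (w : T) : right_continuous (sub_path w).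
Proof.
move=> x; have [x0|x0] := leP 0%R x.
  rewrite /sub_path (max_idPr x0).
  apply: cvg_trans (@sub_right_continuous _ _ _ _ X w x x0).
  apply: near_eq_cvg; near=> y.
  have xy : (x < y)%R by near: y; exact: nbhs_right_gt.
  by rewrite (max_idPr _)// (le_trans x0)// ltW.
rewrite /sub_path (max_idPl (ltW x0)).
apply: cvg_trans (@cvg_cst _ (X 0%R w) _ (x^'+) _).
apply: near_eq_cvg; near=> y.
by rewrite (max_idPl _)// ltW//; near: y; exact: nbhs_right_lt.
Unshelve. all: by end_near. Qed.

HB.instance Definition _ (w : T) := isCumulative.Build R _ R (sub_path w)
  (@sub_path_nondecreasing w) (@sub_path_right_continuous w).

(* Pathwise integral of [h] over ]0, t] against the path of [X]. When [h] is
   singular at the endpoint [t], the value [h t] is irrelevant up to a null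
   event: by stationarity, [X] has no fixed jump time. *)
Definition stieltjes_integral (h : R -> R) (t : R) (w : T) : \bar R :=
  \int[lebesgue_stieltjes_measure (sub_path w)]_(u in `]0%R, t]) (h u)%:E.

End stieltjes.

(* Main.v *)
(* By Frullani's formula the Levy exponent of Gamma_t is
   t E ln (1 + l / (mu + G0)), whose derivative in l is a resolvent
   E 1 / (x + G0). Since (1 + e^(pi c)) times the Cauchy density at c is the
   integral of sin (pi t) e^(pi t c) over t in [0, 1], the resolvent follows from
   Euler's reflection integral of e^(ts) / (1 + e^s) = pi / sin (pi t), which is
   obtained without residues: rotating the contour by pi / 2 relates the values
   at t and t / 2. Integrating the resolvent gives the Laplace transform.

   The laws are then identified by their Laplace transforms at the integers,
   which determine a finite measure on the half-line. For D_1 one uses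
   P (gamma_1 D_1 > a) = E e^(-a / D_1), so that the tail of Gamma_1 is the
   Laplace transform of the law of 1 / D_1.

   For the Wiener-Gamma representation, Riemann sums and independence of the
   increments give E e^(-l I) = exp (- \int_0^t ln (1 + l h (u)) du) for the
   integral I of h against the gamma process, and the image of the Lebesgue
   measure on ]0, t[ by u -> cot (pi u / t) is t times the Cauchy law. *)

Require Import Defs.
From HB Require Import structures.
From mathcomp Require Import all_boot all_order all_algebra.
From mathcomp Require Import all_classical all_reals all_analysis.
From mathcomp Require Import measurable_realfun.
From mathcomp Require Import ring lra.

Set Implicit Arguments.
Unset Strict Implicit.
Unset Printing Implicit Defensive.

Import Order.TTheory GRing.Theory Num.Theory.
Import numFieldNormedType.Exports HBNNSimple.

Local Open Scope classical_set_scope.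
Local Open Scope ring_scope.

(** * Laplace transforms of finite measures on the half-line *)

(** A quarter turn suffices for the contour: it stays away from the pole at [i pi], and on the
    rotated line [e^(t s) / (1 + i e^s)] has real part [e^(t s) / (1 + e^(2 s))], which is the
    original integrand at [t / 2] up to a dilation of [s]. Real parts alone thus close the argument.
    Exchanges of integrals rest on Tonelli for nonnegative functions; the signed integrand of the
    rotation is first shifted by a constant. With [x = l + mu], the resolvent
    [1 / (x (x + 1) ln (1 + 1 / x))] is the derivative of [- ln ln (1 + 1 / x)], whence the power of
    a ratio of logarithms. Integer arguments suffice because the combinations of the [e^(-n x)]
    contain [(1 - e^(-k x))^N], and explicit choices of [k] and [N] converge to indicators of rays.
    The Wiener-Gamma integrand is [1 / (mu + G0)] written in the Cauchy variable: it is bounded by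
    [1 / mu], so that the integral is finite on every path and the Riemann sums are dominated. *)

Section density_measure.
Context d (T : measurableType d) (R : realType) (m : {measure set T -> \bar R}).
Variable f : T -> R.
Hypotheses (f0 : forall x, (0 <= f x)%R) (mf : measurable_fun setT f).
Local Open Scope ereal_scope.

(** The two proofs are arguments so that the measure structure can be inferred from the term
    itself. *)
Definition density_measure of (forall x, (0 <= f x)%R) & measurable_fun setT f :=
  fun A : set T => \int[m]_(x in A) (f x)%:E.
Local Notation nu := (density_measure f0 mf).

Let nu0 : nu set0 = 0. Proof. by rewrite /nu integral_set0. Qed.

Let nu_ge0 A : 0 <= nu A. Proof. by apply: integral_ge0 => x _; rewrite lee_fin. Qed.

Let nu_sigma_additive : semi_sigma_additive nu.
Proof.
move=> /= A mA tA mUA; rewrite /density_measure ge0_integral_bigcup//; last first.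
  by move=> x _; rewrite lee_fin.
  by apply/measurable_EFinP; exact: measurable_funTS.
by apply: is_cvg_ereal_nneg_natsum_cond => n _ _; apply: integral_ge0 => x _; rewrite lee_fin.
Qed.

HB.instance Definition _ := isMeasure.Build _ _ _ nu nu0 nu_ge0
  nu_sigma_additive.

(** Both sides are limits along an increasing sequence of simple functions; on the indicator of a
    level set the identity is the definition of [nu]. *)
Lemma ge0_integral_density_measure (h : T -> \bar R) :
    measurable_fun setT h -> (forall x, 0 <= h x) ->
  \int[nu]_x h x = \int[m]_x ((f x)%:E * h x).
Proof.
move=> mh h0; pose g := nnsfun_approx measurableT mh.
pose gE n x := (g n x)%:E.
transitivity (limn (fun n => \int[nu]_x gE n x)).
  rewrite -monotone_convergence//=.
  - by apply: eq_integral => x _; apply/esym/cvg_lim => //; exact: cvg_nnsfun_approx.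
  - by move=> n; exact/measurable_EFinP.
  - by move=> n x _; rewrite lee_fin.
  - by move=> x _ a b ab; rewrite lee_fin; exact/lefP/nd_nnsfun_approx.
have gEE n x : gE n x =
    \sum_(r \in range (g n)) (r * \1_(g n @^-1` [set r]) x)%:E.
  by rewrite fsumEFin// /gE fimfunE.
transitivity (limn (fun n => \int[m]_x ((f x)%:E * gE n x))).
  congr (lim (_ @ \oo)); apply/funext => n.
  rewrite (eq_integral _ _ (fun x _ => gEE n x)).
  rewrite ge0_integral_fsum//; last 2 first.
  - by move=> r; apply/measurable_EFinP/measurable_funM.
  - by move=> r x _; rewrite EFinM nnfun_muleindic_ge0.
  transitivity (\int[m]_x (\sum_(r \in range (g n))
      (f x)%:E * (r * \1_(g n @^-1` [set r]) x)%:E)); last first.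
    apply: eq_integral => x _; rewrite gEE ge0_mule_fsumr//.
    by move=> r; rewrite EFinM nnfun_muleindic_ge0.
  rewrite ge0_integral_fsum//; last 2 first.
  - move=> r; apply: emeasurable_funM; first exact/measurable_EFinP.
    by apply/measurable_EFinP/measurable_funM.
  - by move=> r x _; rewrite mule_ge0 ?lee_fin// -lee_fin EFinM nnfun_muleindic_ge0.
  apply: eq_fsbigr => r _.
  under eq_integral do rewrite EFinM.
  (* A negative value has an empty level set, since [g n] is nonnegative. *)
  have [r0|r0] := leP 0%R r; last first.
    by rewrite !integral0_eq// => x _;
      rewrite preimage_nnfun0//= indicE in_set0 ?mulr0 ?mule0.
  rewrite ge0_integralZl//; last first.
    by apply/measurable_EFinP; exact: measurable_indic.
  rewrite integral_indic// setIT /= /density_measure.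
  under [RHS]eq_integral do rewrite EFinM muleCA.
  rewrite ge0_integralZl//; last 2 first.
  - by apply: emeasurable_funM; apply/measurable_EFinP => //; exact: measurable_indic.
  - by move=> x _; rewrite mule_ge0 ?lee_fin//.
  by congr (_ * _); rewrite integral_mkcond epatch_indic.
rewrite -monotone_convergence//=.
- apply: eq_integral => x _; apply/cvg_lim => //.
  by apply: cvgeZl => //; exact: cvg_nnsfun_approx.
- by move=> n; apply: emeasurable_funM => //; exact/measurable_EFinP.
- by move=> n x _; rewrite mule_ge0 ?lee_fin//.
- by move=> x _ a b ab; apply: lee_wpmul2l; rewrite lee_fin//;
    exact/lefP/nd_nnsfun_approx.
Qed.
End density_measure.

Section laplace_uniqueness.
Context {R : realType}.
Implicit Types (a x y : R) (n k j N : nat).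

Lemma bernoulli_ineq y N : 0 <= y <= 1 -> 1 - N%:R * y <= (1 - y) ^+ N.
Proof.
move=> /andP[y0 y1]; elim: N => [|N IH]; first by rewrite mul0r subr0 expr0.
rewrite exprSr -natr1; apply: (@le_trans _ _ ((1 - N%:R * y) * (1 - y))).
  have : 0 <= N%:R * y * y by rewrite !mulr_ge0.
  by nra.
by rewrite ler_wpM2r// subr_ge0.
Qed.

(* [(1 - e^(-k x))^(e^(k a))] behaves like [exp (- e^(k (a - x)))], which tends
   to the indicator of [a < x] as [k] grows. The extra factor [n.+1] in the
   exponent forces the limit 0 at [x = a]. *)
Definition ray_exponent a n : nat :=
  (n.+1 * Num.truncn (expR (n.+1%:R * a)))%N.

Definition ray_approx a n x : R :=
  (1 - expR (- n.+1%:R * x)) ^+ ray_exponent a n.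

Lemma ray_approx01 a n x : 0 <= x -> 0 <= ray_approx a n x <= 1.
Proof.
move=> x0; have e1 : expR (- n.+1%:R * x) <= 1.
  by rewrite -expR0 ler_expR mulNr oppr_le0 mulr_ge0.
by rewrite exprn_ge0 ?subr_ge0// exprn_ile1 ?subr_ge0// lerBlDr lerDl expR_ge0.
Qed.

Lemma le_truncn_half y : 1 <= y -> y / 2 <= (Num.truncn y)%:R.
Proof.
move=> y1; have y0 : 0 <= y by rewrite (le_trans _ y1).
have := truncnS_gt y; rewrite -natr1 => H.
have : (1 : R) <= (Num.truncn y)%:R.
  by rewrite ler1n truncn_gt0.
lra.
Qed.

Lemma cvg_ray_approx a x : 0 <= a -> 0 <= x ->
  ray_approx a n x @[n --> \oo] --> (\1_(`]a, +oo[) x : R).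
Proof.
move=> a0 x0.
suff [C HC] : exists C, forall n,
    `|\1_(`]a, +oo[) x - ray_approx a n x| <= C * harmonic n.
  apply/cvgrPdist_le => e e0.
  have : C * harmonic n @[n --> \oo] --> C * 0.
    by apply: cvgMr; exact: cvg_harmonic.
  rewrite mulr0 => /cvgr0_norm_le /(_ _ e0) H; near=> n.
  apply: (le_trans (HC n)); apply: (le_trans (ler_norm _)); near: n; exact: H.
have key n : 0 <= expR (- n.+1%:R * x) <= 1.
  by rewrite expR_ge0/= -expR0 ler_expR mulNr oppr_le0 mulr_ge0.
have [ax|xa] := ltP a x.
(* Let [k = n.+1] and let [N <= k e^(k a)] be the exponent. Bernoulli bounds the error by
   [N e^(-k x)], hence by [k e^(-d)] with [d = k (x - a)]; then [e^d >= d^2 / 2] leaves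
   [2 / (k (x - a)^2)]. *)
- exists (2 / (x - a) ^+ 2) => n.
  have -> : \1_(`]a, +oo[) x = 1 :> R by rewrite indicE mem_set//= in_itv/= ax.
  have /andP[_ h1] := ray_approx01 a n x0.
  rewrite ger0_norm ?subr_ge0//.
  have := bernoulli_ineq (ray_exponent a n) (key n).
  rewrite -/(ray_approx a n x) => H.
  rewrite lerBlDr -lerBlDl (le_trans _ H)// lerB//.
  rewrite /ray_exponent natrM -mulrA /=.
  apply: (@le_trans _ _ (n.+1%:R * expR (- (n.+1%:R * (x - a))))).
    rewrite ler_wpM2l// mulrBr opprB expRD mulNr ler_wpM2r ?expR_ge0//.
    by rewrite truncn_le expR_ge0.
  have d0 : 0 < n.+1%:R * (x - a) by rewrite mulr_gt0 ?subr_gt0.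
  have := expR_ge1Dxn 1 (ltW d0); set d := n.+1%:R * (x - a) in d0 *.
  move=> he; rewrite expRN ler_pdivrMr ?expR_gt0//=.
  apply: (@le_trans _ _ (2 / (x - a) ^+ 2 / n.+1%:R * (d ^+ 2 / 2))); last first.
    rewrite ler_wpM2l ?mulr_ge0 ?invr_ge0 ?sqr_ge0//.
    by rewrite (le_trans _ he)// lerDr.
  rewrite /d exprMn le_eqVlt; apply/orP; left; apply/eqP; field.
  apply/andP; split; last by rewrite subr_eq0 gt_eqF.
  by rewrite gt_eqF// ltr_pwDl.
(* Here [(1 - y)^N <= e^(- N y)] with [y = e^(-k x)] and [k = n.+1]. Since [x <= a] and truncation
   loses at most half, [N y >= k / 2], and [e^(- k / 2) <= 2 / k]. *)
- exists 2 => n.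
  have -> : \1_(`]a, +oo[) x = 0 :> R.
    by rewrite indicE memNset//= in_itv/= andbT; apply/negP; rewrite -leNgt.
  have /andP[h1 _] := ray_approx01 a n x0.
  rewrite sub0r normrN ger0_norm//.
  apply: (@le_trans _ _ (expR (- expR (- n.+1%:R * x)) ^+ ray_exponent a n)).
    have /andP[e0 e1] := key n.
    by rewrite lerXn2r// ?nnegrE ?subr_ge0 ?expR_ge0// expR_ge1Dx.
  rewrite -expRM_natl mulrN.
  have h2 : n.+1%:R / 2 <= (ray_exponent a n)%:R * expR (- n.+1%:R * x).
    rewrite natrM -mulrA ler_wpM2l//.
    have e1 : 1 <= expR (n.+1%:R * a) by rewrite -expR0 ler_expR mulr_ge0.
    apply: (@le_trans _ _ (expR (n.+1%:R * a) / 2 * expR (- n.+1%:R * x))); last first.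
      by rewrite ler_wpM2r ?expR_ge0// le_truncn_half.
    rewrite mulrAC -expRD -[leLHS]mul1r ler_wpM2r//.
    by rewrite -expR0 ler_expR mulNr -mulrBr mulr_ge0// subr_ge0.
  apply: (@le_trans _ _ (expR (- (n.+1%:R / 2)))).
    by rewrite ler_expR lerN2.
  rewrite expRN /= invf_ple ?posrE ?expR_gt0 ?mulr_gt0//.
  rewrite invfM invrK (le_trans _ (expR_ge1Dx _))//; lra.
Unshelve. all: by end_near. Qed.

Local Notation D := (`[0%R, +oo[%classic : set R).

Lemma laplace_polyE (m : {finite_measure set (measurableTypeR R) -> \bar R}) k j N :
  m.-integrable D
    (fun x => (expR (- j%:R * x) * (1 - expR (- k%:R * x)) ^+ N)%:E).
Proof.
have H := finite_measure_integrable_cst m 1 (measurable_itv `[0%R, +oo[).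
apply: le_integrable H => //.
  apply/measurable_EFinP/measurable_funM => //.
    exact/measurableT_comp/measurable_funM.
  apply: measurable_funX; apply: measurable_funB => //.
  exact/measurableT_comp/measurable_funM.
move=> x /=; rewrite in_itv/= andbT => x0.
have e i : 0 <= expR (- i%:R * x) <= 1.
  by rewrite expR_ge0/= -expR0 ler_expR mulNr oppr_le0 mulr_ge0.
have /andP[e0 e1] := e k; have /andP[e2 e3] := e j.
rewrite lee_fin ger0_norm ?mulr_ge0 ?exprn_ge0 ?subr_ge0// ger0_norm//.
by rewrite mulr_ile1// ?exprn_ge0 ?subr_ge0// exprn_ile1 ?subr_ge0// lerBlDr lerDl.
Qed.

Section two_measures.
Variables m1 m2 : {finite_measure set (measurableTypeR R) -> \bar R}.
Hypotheses (m1_0 : m1 `]-oo, 0[%classic = 0%E) (m2_0 : m2 `]-oo, 0[%classic = 0%E).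
Hypothesis m12 : forall n, (\int[m1]_(x in D) (expR (- n%:R * x))%:E =
                            \int[m2]_(x in D) (expR (- n%:R * x))%:E)%E.

(** With [y = e^(-k x)], [(1 - y)^(N + 1) = (1 - y)^N - y (1 - y)^N], and the factor [y] only shifts
    [j] by [k]. This is why [j] is present and varies in the induction. *)
Let laplace_poly_eq k j N :
  (\int[m1]_(x in D) (expR (- j%:R * x) * (1 - expR (- k%:R * x)) ^+ N)%:E =
   \int[m2]_(x in D) (expR (- j%:R * x) * (1 - expR (- k%:R * x)) ^+ N)%:E)%E.
Proof.
elim: N j => [|N IH] j.
  by under eq_integral do rewrite expr0 mulr1;
     under [RHS]eq_integral do rewrite expr0 mulr1.
have H (m : {finite_measure set (measurableTypeR R) -> \bar R}) :
  (\int[m]_(x in D) (expR (- j%:R * x) * (1 - expR (- k%:R * x)) ^+ N.+1)%:E =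
   \int[m]_(x in D) (expR (- j%:R * x) * (1 - expR (- k%:R * x)) ^+ N)%:E -
   \int[m]_(x in D) (expR (- (j + k)%:R * x) * (1 - expR (- k%:R * x)) ^+ N)%:E)%E.
  rewrite -integralB_EFin//; last 2 first.
  - exact: laplace_polyE.
  - exact: laplace_polyE.
  apply: eq_integral => x _; congr EFin.
  have -> : expR (- (j + k)%:R * x) = expR (- j%:R * x) * expR (- k%:R * x).
    by rewrite -expRD natrD; congr expR; ring.
  by rewrite exprS; ring.
by rewrite !H !IH.
Qed.

Let ray_eq a : 0 <= a -> m1 (D `&` `]a, +oo[) = m2 (D `&` `]a, +oo[).
Proof.
move=> a0.
have H (m : {finite_measure set (measurableTypeR R) -> \bar R}) :
    (\int[m]_(x in D) (ray_approx a n x)%:E)%E @[n --> \oo] --> m (D `&` `]a, +oo[).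
  have := @dominated_convergence _ _ _ m D (measurable_itv `[0%R, +oo[)
    (fun n x => (ray_approx a n x)%:E) (fun x => (\1_(`]a, +oo[) x)%:E) (cst 1%E).
  move=> []//.
  - move=> n; apply/measurable_EFinP; apply: measurable_funX.
    by apply: measurable_funB => //; exact/measurableT_comp/measurable_funM.
  - by apply/measurable_EFinP.
  - apply: aeW => x; rewrite /= in_itv/= andbT => x0.
    by apply: cvg_EFin; [exact: nearW|exact: cvg_ray_approx].
  - have H := finite_measure_integrable_cst m 1 (measurable_itv `[0%R, +oo[).
    exact: H.
  - apply: aeW => x n; rewrite /= in_itv/= andbT => x0.
    by have /andP[? ?] := ray_approx01 a n x0; rewrite lee_fin ger0_norm.
  by move=> _ _; rewrite integral_indic// setIC.
apply: (cvg_unique _ (H m1)) => //; move: (H m2).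
rewrite (_ : (fun n => _) = (fun n =>
   \int[m1]_(x in D) (ray_approx a n x)%:E)%E)//.
apply/funext => n; have := laplace_poly_eq n.+1 0 (ray_exponent a n).
under eq_integral do rewrite oppr0 mul0r expR0 mul1r.
by under [RHS]eq_integral do rewrite oppr0 mul0r expR0 mul1r.
Qed.

(** Open rays to the right generate the Borel sets and are stable under intersection. A ray starting
    below 0 has the mass of the half-line, which is the transform at 0. *)
Theorem laplace_measure_unique (A : set R) : measurable A -> m1 A = m2 A.
Proof.
move=> mA.
apply: (@measure_unique _ R (measurableTypeR R) [set A | exists x, A = `]x, +oo[%classic]
  (fun k => `]- k%:R, +oo[%classic)) => //.
- exact: RGenOInfty.measurableE.
- move=> _ _ [x ->] [y ->]; exists (Num.max x y).
  by apply/seteqP; split => z/=; rewrite !in_itv/= !andbT gt_max => /andP.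
- by move=> i; exists (- i%:R).
- apply/seteqP; split=> // x _; exists (Num.truncn `|x|).+1 => //=.
  rewrite in_itv/= andbT ltrNl (le_lt_trans _ (truncnS_gt _))//.
  by rewrite -normrN ler_norm.
- move=> _ [x ->].
  have H (m : {finite_measure set (measurableTypeR R) -> \bar R}) :
      m `]-oo, 0[%classic = 0%E -> m `]x, +oo[%classic = m (D `&` `]x, +oo[).
    move=> m0; have E := measureDI m (measurable_itv `]x, +oo[) (measurable_itv `[0%R, +oo[).
    apply: (eq_trans E); apply: (eq_trans _ (add0e _)); congr (_ + _)%E; last by rewrite setIC.
    apply: (subset_measure0 _ _ _ m0) => //; first exact: measurableD.
    by move=> y/=; rewrite !in_itv/= !andbT => -[_ /negP]; rewrite -ltNge.
  apply: (eq_trans (H _ m1_0)); apply: (eq_trans _ (esym (H _ m2_0))).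
  have [x0|x0] := leP 0 x; first exact: ray_eq.
  rewrite (_ : D `&` _ = D); last first.
    by apply/setIidPl => y/=; rewrite !in_itv/= !andbT; exact: lt_le_trans.
  have := m12 0; under eq_integral do rewrite oppr0 mul0r expR0.
  under [RHS]eq_integral do rewrite oppr0 mul0r expR0.
  by rewrite !integral_cst// !mul1e.
- by move=> k; rewrite ltey_eq fin_num_measure.
Qed.
End two_measures.
End laplace_uniqueness.

(** * Integrals on the line *)

Section calculus.
Context {R : realType}.
Local Notation mu := (@lebesgue_measure R).
Implicit Types (a b l x y t : R) (f F : R -> R).

Lemma FTC_segment f F a b : a < b ->
  (forall x, a <= x <= b -> {for x, continuous f}) ->
  (forall x, a <= x <= b -> is_derive x 1 F (f x)) ->
  (\int[mu]_(x in `[a, b]) (f x)%:E = (F b - F a)%:E)%E.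
Proof.
move=> ab cf dF.
have cF x : a <= x <= b -> {for x, continuous F}.
  by move=> /dF[dFx _]; exact/differentiable_continuous/derivable1_diffP.
rewrite (continuous_FTC2 (F := F))//.
- apply: continuous_in_subspaceT => x; rewrite inE/= in_itv/=; exact: cf.
- split.
  + by move=> x; rewrite in_itv/= => /andP[ax xb]; have [] := dF x; rewrite ?ltW.
  + by apply: cvg_at_right_filter; apply: cF; rewrite lexx ltW.
  + by apply: cvg_at_left_filter; apply: cF; rewrite lexx ltW.
- move=> x; rewrite in_itv/= => /andP[ax xb].
  by rewrite derive1E; have [|_ <-] := dF x; rewrite ?ltW.
Qed.

Lemma ge0_FTC_ray f F a l :
  (forall x, a <= x -> 0 <= f x) ->
  (forall x, a <= x -> {for x, continuous f}) ->
  (forall x, a <= x -> is_derive x 1 F (f x)) ->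
  F x @[x --> +oo] --> l ->
  (\int[mu]_(x in `[a, +oo[) (f x)%:E = (l - F a)%:E)%E.
Proof.
move=> f0 cf dF Fl.
have cF x : a <= x -> {for x, continuous F}.
  by move=> /dF[dFx _]; exact/differentiable_continuous/derivable1_diffP.
rewrite (ge0_continuous_FTC2y (F := F) (l := l))//.
- apply: continuous_in_subspaceT => x; rewrite inE/= in_itv/= andbT; exact: cf.
- by move=> x ax; have [] := dF x; rewrite ?ltW.
- by apply: cvg_at_right_filter; apply: cF.
- move=> x; rewrite in_itv/= andbT => ax.
  by rewrite derive1E; have [|_ <-] := dF x; rewrite ?ltW.
Qed.

(** Nonnegativity is asked on [A] and [B] alone: multiplying the integrand by the two indicators
    makes it nonnegative on the whole product. *)
Lemma ge0_tonelli_on d1 d2 (T1 : measurableType d1) (T2 : measurableType d2)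
    (m1 : {sigma_finite_measure set T1 -> \bar R})
    (m2 : {sigma_finite_measure set T2 -> \bar R}) (A : set T1) (B : set T2)
    (f : T1 -> T2 -> R) : measurable A -> measurable B ->
  measurable_fun setT (fun z => f z.1 z.2) ->
  (forall u v, A u -> B v -> 0 <= f u v) ->
  (\int[m1]_(x in A) \int[m2]_(y in B) (f x y)%:E =
   \int[m2]_(y in B) \int[m1]_(x in A) (f x y)%:E)%E.
Proof.
move=> mA mB mf f0.
pose g z := (f z.1 z.2 * (\1_A z.1 * \1_B z.2))%:E.
have g0 z : (0 <= g z)%E.
  rewrite lee_fin !indicE; have [zA|] := boolP (z.1 \in A); last by rewrite mul0r mulr0.
  have [zB|] := boolP (z.2 \in B); last by rewrite !mulr0.
  by rewrite !mulr1 f0// -in_setE.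
have mg : measurable_fun setT g.
  apply/measurable_EFinP/measurable_funM => //; apply: measurable_funM.
    exact: (measurableT_comp (measurable_indic _)).
  exact: (measurableT_comp (measurable_indic _)).
have := fubini_tonelli (m1 := m1) (m2 := m2) g mg g0.
have -> : (\int[m1]_x \int[m2]_y g (x, y) =
          \int[m1]_(x in A) \int[m2]_(y in B) (f x y)%:E)%E.
  rewrite [RHS]integral_mkcond; apply: eq_integral => x _; rewrite patchE.
  case: ifPn => xA.
    rewrite [RHS]integral_mkcond; apply: eq_integral => y _; rewrite patchE /g/=.
    by rewrite !indicE xA mul1r; case: ifPn => yB; rewrite ?mulr1 ?mulr0.
  by apply: integral0_eq => y _; rewrite /g/= !indicE (negbTE xA) mul0r mulr0.
move=> ->.
rewrite [RHS]integral_mkcond; apply: eq_integral => y _; rewrite patchE.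
case: ifPn => yB.
  rewrite [RHS]integral_mkcond; apply: eq_integral => x _; rewrite patchE /g/=.
  by rewrite !indicE yB mulr1; case: ifPn => xA; rewrite ?mulr1 ?mulr0.
by apply: integral0_eq => x _; rewrite /g/= !indicE (negbTE yB) !mulr0.
Qed.

Lemma cvg_expRNy a : 0 < a -> expR (- a * x) @[x --> +oo] --> (0 : R).
Proof.
move=> a0.
rewrite (_ : (fun x => expR (- a * x)) =
             (fun z => expR (- z)) \o (fun z => a * z)); last first.
  by apply: eq_fun => x; rewrite mulNr.
apply: (@cvg_comp _ _ _ _ _ _ (pinfty_nbhs R)); last exact: cvgr_expR.
exact: gt0_cvgMry.
Qed.

Lemma continuous_expRM a : continuous (fun x => expR (a * x)).
Proof.
move=> x; apply: (@continuous_comp _ _ _ (fun x => a * x) expR).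
  exact: mulrl_continuous.
exact: continuous_expR.
Qed.

Lemma measurable_expRM a (D : set R) : measurable_fun D (fun x => expR (a * x)).
Proof.
apply: measurable_funTS; apply: continuous_measurable_fun.
exact: continuous_expRM.
Qed.

Lemma measurable_EFin_expRM a (D : set R) :
  measurable_fun D (fun x => (expR (a * x))%:E).
Proof. by apply/measurable_EFinP; exact: measurable_expRM. Qed.

Lemma integral_expRM_ray a b : 0 < a ->
  (\int[mu]_(x in `[b, +oo[) (expR (- a * x))%:E = (expR (- a * b) / a)%:E)%E.
Proof.
move=> a0; pose F x := - a^-1 * expR (- a * x).
have dF x : b <= x -> is_derive x 1 F (expR (- a * x)).
  move=> _; apply: trigger_derive; rewrite /GRing.scale/=; field.
  by rewrite gt_eqF.
rewrite (ge0_FTC_ray (l := 0) _ _ dF).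
- by congr EFin; rewrite /F; ring.
- by move=> x _; exact: expR_ge0.
- by move=> x _; exact: continuous_expRM.
- by rewrite -(mulr0 (- a^-1)); apply: cvgMr; exact: cvg_expRNy.
Qed.

Lemma integral_expRM_segment a l x : 0 < x -> 0 < l ->
  (\int[mu]_(v in `[0%R, l]) (expR (- (a + v) * x))%:E =
   ((1 - expR (- l * x)) / x * expR (- a * x))%:E)%E.
Proof.
move=> x0 l0.
pose F v := - x^-1 * expR (- (a + v) * x).
have dF v : 0 <= v <= l -> is_derive v 1 F (expR (- (a + v) * x)).
  move=> _; apply: trigger_derive; rewrite /GRing.scale/=; field.
  by rewrite gt_eqF.
rewrite (FTC_segment l0 _ dF).
- congr EFin; rewrite /F addr0 opprD mulrDl expRD; ring.
- move=> v _.
  rewrite (_ : (fun v => _) = (fun v => expR (- a * x) * expR (- x * v))).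
    by apply: cvgMr; exact: continuous_expRM.
  by apply/funext => w; rewrite -expRD; congr expR; ring.
Qed.

Lemma integral_inv_segment a l : 0 < a -> 0 < l ->
  (\int[mu]_(v in `[0%R, l]) (a + v)^-1%:E = (ln (1 + l / a))%:E)%E.
Proof.
move=> a0 l0.
have p v : 0 <= v <= l -> 0 < a + v by move=> /andP[v0 _]; rewrite ltr_wpDr.
have dF v : 0 <= v <= l -> is_derive v 1 (fun v => ln (a + v)) (a + v)^-1.
  move=> /p av; have := is_derive1_ln av => H.
  by apply: trigger_derive; rewrite /GRing.scale/=; ring.
rewrite (FTC_segment l0 _ dF).
- congr EFin; rewrite addr0 -ln_div ?posrE ?addr_gt0//; congr ln.
  by field; rewrite gt_eqF.
- move=> v /p av; apply: cvgV; first by rewrite gt_eqF.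
  by apply: cvgD; [exact: cvg_cst|exact: cvg_id].
Qed.

(** [(1 - e^(-l x)) / x] is the integral of [e^(-v x)] over [v] in [0, l]; Tonelli then leaves the
    integral of [1 / (a + v)]. *)
Lemma frullani a l : 0 < a -> 0 <= l ->
  (\int[mu]_(x in `]0%R, +oo[) ((1 - expR (- l * x)) / x * expR (- a * x))%:E =
   (ln (1 + l / a))%:E)%E.
Proof.
move=> a0; rewrite le_eqVlt => /predU1P[<-|l0].
  rewrite mul0r addr0 ln1; apply: integral0_eq => x _.
  by rewrite oppr0 mul0r expR0 subrr !mul0r.
transitivity (\int[mu]_(x in `]0%R, +oo[)
    \int[mu]_(v in `[0%R, l]) (expR (- (a + v) * x))%:E)%E.
  apply: eq_integral => x; rewrite inE/= in_itv/= andbT => x0.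
  by rewrite integral_expRM_segment.
rewrite ge0_tonelli_on//; last first.
  apply: measurableT_comp => //; apply: measurable_funM => //.
  by apply: measurableT_comp => //; exact: measurable_funD.
rewrite -integral_inv_segment//; apply: eq_integral => v.
rewrite inE/= in_itv/= => /andP[v0 _].
rewrite integral_itv_obnd_cbnd; last exact: measurable_EFin_expRM.
by rewrite integral_expRM_ray ?ltr_wpDr// mulr0 expR0 mul1r.
Qed.

Lemma measurable_inv : measurable_fun setT (@GRing.inv R).
Proof.
rewrite -(setvU [set (0 : R)]); apply/measurable_funU => //.
  exact: measurableC.
split; last exact: measurable_fun_set1.
apply: open_continuous_measurable_fun.
  rewrite (_ : ~` _ = [set x : R | x != 0]); first exact: open_neq.
  by apply/seteqP; split => x /= /eqP.
move=> x; rewrite inE/= => /eqP x0.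
exact: inv_continuous.
Qed.

Lemma segment_integrable f a b :
  (forall x, a <= x <= b -> {for x, continuous f}) ->
  mu.-integrable `[a, b] (EFin \o f).
Proof.
move=> cf; apply: continuous_compact_integrable; first exact: segment_compact.
by apply: continuous_in_subspaceT => x; rewrite inE/= in_itv/=; exact: cf.
Qed.

Lemma ge0_integralT_lim f : measurable_fun setT f -> (forall x, 0 <= f x) ->
  (\int[mu]_(x in `[(- n%:R)%R, n%:R%R]) (f x)%:E)%E @[n --> \oo] -->
  (\int[mu]_x (f x)%:E)%E.
Proof.
move=> mf f0.
have -> : setT = \bigcup_n (`[- n%:R, n%:R]%classic : set R).
  apply/seteqP; split => // x _; exists (Num.truncn `|x|).+1 => //=.
  by rewrite in_itv/= -ler_norml ltW// truncnS_gt.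
apply: ge0_nondecreasing_set_cvg_integral => //.
- move=> m n mn; apply/subsetPset/subset_itv; rewrite bnd_simp.
    by rewrite lerN2 ler_nat.
  by rewrite ler_nat.
- by move=> n; exact/measurable_funTS/measurable_EFinP.
- by move=> n x _; rewrite lee_fin.
Qed.

Lemma ge0_integralT_split f : continuous f -> (forall x, 0 <= f x) ->
  (\int[mu]_x (f x)%:E = \int[mu]_(x in `[0%R, +oo[) (f (- x))%:E +
                         \int[mu]_(x in `[0%R, +oo[) (f x)%:E)%E.
Proof.
move=> cf f0.
have mf (D : set R) : measurable_fun D (fun x => (f x)%:E).
  by apply/measurable_EFinP/measurable_funTS; exact: continuous_measurable_fun.
rewrite -(setUv `]-oo, 0%R]%classic) ge0_integral_setU//=; last 4 first.
- exact: measurableC.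
- exact: mf.
- by move=> x _; rewrite lee_fin.
- exact/disj_setPCl.
rewrite setCitvl integral_itv_obnd_cbnd//; congr (_ + _)%E.
rewrite -[in LHS](oppr0 R) ge0_integration_by_substitutionNy//.
exact: continuous_subspaceT.
Qed.

Lemma integralT_affine f a b : 0 < a -> continuous f -> (forall x, 0 <= f x) ->
  (\int[mu]_x (f x)%:E = \int[mu]_x (a * f (a * x + b))%:E)%E.
Proof.
move=> a0 cf f0; pose F x := (x + b / a) * a.
have FE x : F x = a * x + b by rewrite /F; field; rewrite gt_eqF.
have dF x : is_derive x 1 F a.
  by apply: trigger_derive; rewrite /GRing.scale/=; ring.
have F'E : F^`()%classic = cst a.
  by apply/funext => x; rewrite derive1E; exact: derive_val.
rewrite (increasing_ge0_integration_by_substitutionT (F := F))//.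
- have E x : ((f \o F) * F^`()%classic) x = a * f (a * x + b).
    by rewrite F'E -[LHS]/(f (F x) * a) FE mulrC.
  by apply: eq_integral => x _; rewrite E.
- by move=> x y xy; rewrite !FE ltrD2r ltr_pM2l.
- by rewrite F'E => x; exact: cvg_cst.
- by rewrite F'E; exact: is_cvg_cst.
- by rewrite F'E; exact: is_cvg_cst.
- by apply/gt0_cvgMlNy => //; exact: cvg_addrr_Ny.
- by apply/gt0_cvgMly => //; exact: cvg_addrr.
Qed.

End calculus.

(** * The integral of e^(ts) / (1 + e^s) *)

Section rotation.
Context {R : realType}.
Local Notation mu := (@lebesgue_measure R).
Variable t : R.
Hypotheses (t0 : 0 < t) (t1 : t < 1).
Implicit Types s theta M : R.

(* [U + i V = e^(t (s + i (theta - pi / 2))) / (1 + e^(s + i theta))]. The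
   Cauchy-Riemann equation [dU/dtheta = w = - dV/ds] makes the integral of [U]
   over [s] independent of [theta]. *)
Let N s theta := 1 + 2 * expR s * cos theta + expR s ^+ 2.
(** [P - i Q] is [1 / (1 + e^(s + i theta))], and [N] is the squared modulus of the denominator;
    [Ps] and [Qs] are the derivatives of [P] and [Q] in [s]. *)
Let P s theta := (1 + expR s * cos theta) / N s theta.
Let Q s theta := expR s * sin theta / N s theta.
Let Ps s theta := - (expR s * (cos theta * (1 + expR s ^+ 2) + 2 * expR s)) / N s theta ^+ 2.
Let Qs s theta := expR s * sin theta * (1 - expR s ^+ 2) / N s theta ^+ 2.
(** The shift by pi / 2 makes the phase vanish at [theta = pi / 2], so that [U] there has no
    trigonometric factor; at [theta = 0] the phase contributes [cos (t * (pi / 2))]. *)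
Let alpha theta := t * (theta - pi / 2).
Let U s theta := expR (t * s) * (cos (alpha theta) * P s theta + sin (alpha theta) * Q s theta).
Let V s theta := expR (t * s) * (sin (alpha theta) * P s theta - cos (alpha theta) * Q s theta).
Let w s theta := expR (t * s) *
  (- t * sin (alpha theta) * P s theta + t * cos (alpha theta) * Q s theta
   + cos (alpha theta) * Qs s theta - sin (alpha theta) * Ps s theta).

Let cos_ge0 theta : 0 <= theta <= pi / 2 -> 0 <= cos theta.
Proof.
move=> /andP[h0 h1]; apply: cos_ge0_pihalf; rewrite h1 andbT.
by rewrite (le_trans _ h0)// oppr_le0 divr_ge0// pi_ge0.
Qed.

(** On the quarter turn [cos theta] is nonnegative, which keeps the pole [s + i theta = i pi] away,
    uniformly in [theta]. *)
Let N_ge s theta : 0 <= theta <= pi / 2 -> 1 + expR s ^+ 2 <= N s theta.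
Proof.
move=> /cos_ge0 c0; rewrite /N lerD2r lerDl mulr_ge0// mulr_ge0// expR_ge0.
Qed.

Let N_ge1 s theta : 0 <= theta <= pi / 2 -> 1 <= N s theta.
Proof. by move=> /(N_ge s); apply: le_trans; rewrite lerDl sqr_ge0. Qed.

Let N_neq0 s theta : 0 <= theta <= pi / 2 -> N s theta != 0.
Proof. by move=> /(N_ge1 s) h; rewrite gt_eqF// (lt_le_trans _ h). Qed.

Let dN_s s theta : is_derive s 1 (N^~ theta) (2 * expR s * cos theta + 2 * expR s ^+ 2).
Proof. by apply: trigger_derive; rewrite /GRing.scale/=; ring. Qed.

Let dN_theta s theta : is_derive theta 1 (N s) (- 2 * expR s * sin theta).
Proof. by apply: trigger_derive; rewrite /GRing.scale/=; ring. Qed.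

Let dP_s s theta : 0 <= theta <= pi / 2 -> is_derive s 1 (P^~ theta) (Ps s theta).
Proof.
move=> h; have n0 := N_neq0 s h; have dN := dN_s s theta.
apply: trigger_derive; rewrite /GRing.scale/= /Ps; move: n0; rewrite /N => n0.
by field.
Qed.

Let dQ_s s theta : 0 <= theta <= pi / 2 -> is_derive s 1 (Q^~ theta) (Qs s theta).
Proof.
move=> h; have n0 := N_neq0 s h; have dN := dN_s s theta.
apply: trigger_derive; rewrite /GRing.scale/= /Qs; move: n0; rewrite /N => n0.
by field.
Qed.

Let dP_theta s theta : 0 <= theta <= pi / 2 -> is_derive theta 1 (P s) (Qs s theta).
Proof.
move=> h; have n0 := N_neq0 s h; have dN := dN_theta s theta.
apply: trigger_derive; rewrite /GRing.scale/= /Qs; move: n0; rewrite /N => n0.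
by field.
Qed.

Let dQ_theta s theta : 0 <= theta <= pi / 2 -> is_derive theta 1 (Q s) (- Ps s theta).
Proof.
move=> h; have n0 := N_neq0 s h; have dN := dN_theta s theta.
apply: trigger_derive; rewrite /GRing.scale/= /Ps.
(* The identity needs [sin^2 + cos^2 = 1], which [field] does not know; this form isolates the
   square of the sine. *)
transitivity ((2 * expR s ^+ 2 * sin theta ^+ 2 +
  expR s * cos theta * N s theta) / N s theta ^+ 2); first by field.
by rewrite sin2cos2; move: n0; rewrite /N => n0; field.
Qed.

Let dU s theta : 0 <= theta <= pi / 2 -> is_derive theta 1 (U s) (w s theta).
Proof.
move=> h; have dP := dP_theta s h; have dQ := dQ_theta s h.
by apply: trigger_derive; rewrite /GRing.scale/= /w/alpha; ring.
Qed.

Let dV s theta : 0 <= theta <= pi / 2 -> is_derive s 1 (V^~ theta) (- w s theta).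
Proof.
move=> h; have dP := dP_s s h; have dQ := dQ_s s h.
by apply: trigger_derive; rewrite /GRing.scale/= /w/alpha; ring.
Qed.

Let cQs_theta s theta : 0 <= theta <= pi / 2 -> {for theta, continuous (Qs s)}.
Proof.
move=> h; have n0 := N_neq0 s h; have dN := dN_theta s theta.
apply: cvgM; last first.
  apply: cvgV; first by rewrite sqrf_eq0.
  apply: (@continuous_comp _ _ _ (N s) (fun x => x ^+ 2)); last exact: exprn_continuous.
  by have [dd _] := dN; exact/differentiable_continuous/derivable1_diffP.
apply: cvgM; last exact: cvg_cst.
by apply: cvgM; [exact: cvg_cst|exact: continuous_sin].
Qed.

Let cPs_theta s theta : 0 <= theta <= pi / 2 -> {for theta, continuous (Ps s)}.
Proof.
move=> h; have n0 := N_neq0 s h; have dN := dN_theta s theta.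
apply: cvgM; last first.
  apply: cvgV; first by rewrite sqrf_eq0.
  apply: (@continuous_comp _ _ _ (N s) (fun x => x ^+ 2)); last exact: exprn_continuous.
  by have [dd _] := dN; exact/differentiable_continuous/derivable1_diffP.
apply: cvgN; apply: cvgM; first exact: cvg_cst.
apply: cvgD; last exact: cvg_cst.
by apply: cvgM; [exact: continuous_cos|exact: cvg_cst].
Qed.

Let calpha theta : {for theta, continuous alpha}.
Proof.
apply: cvgM; first exact: cvg_cst.
by apply: cvgB; [exact: cvg_id|exact: cvg_cst].
Qed.

Let csin_alpha theta : {for theta, continuous (fun x => sin (alpha x))}.
Proof. by apply: continuous_comp; [exact: calpha|exact: continuous_sin]. Qed.

Let ccos_alpha theta : {for theta, continuous (fun x => cos (alpha x))}.
Proof. by apply: continuous_comp; [exact: calpha|exact: continuous_cos]. Qed.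

Let cw_theta s theta : 0 <= theta <= pi / 2 -> {for theta, continuous (w s)}.
Proof.
move=> h.
have cP : {for theta, continuous (P s)}.
  by have [dd _] := dP_theta s h; exact/differentiable_continuous/derivable1_diffP.
have cQ : {for theta, continuous (Q s)}.
  by have [dd _] := dQ_theta s h; exact/differentiable_continuous/derivable1_diffP.
have cQs := cQs_theta (s := s) h; have cPs := cPs_theta (s := s) h.
have cs := @csin_alpha theta; have cc := @ccos_alpha theta.
apply: cvgM; first exact: cvg_cst.
apply: cvgB; last exact: cvgM.
apply: cvgD; last exact: cvgM.
by apply: cvgD; apply: cvgM => //; apply: cvgM => //; exact: cvg_cst.
Qed.

Let cN_s s theta : {for s, continuous (N^~ theta)}.
Proof.
by have [dd _] := dN_s s theta; exact/differentiable_continuous/derivable1_diffP.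
Qed.

Let cQs_s s theta : 0 <= theta <= pi / 2 -> {for s, continuous (Qs^~ theta)}.
Proof.
move=> h; have n0 := N_neq0 s h.
apply: cvgM; last first.
  apply: cvgV; first by rewrite sqrf_eq0.
  by apply: (@continuous_comp _ _ _ (N^~ theta) (fun x => x ^+ 2)); last exact: exprn_continuous.
apply: cvgM.
  by apply: cvgM; [exact: continuous_expR|exact: cvg_cst].
apply: cvgB; first exact: cvg_cst.
by apply: (@continuous_comp _ _ _ expR (fun x => x ^+ 2)); [exact: continuous_expR|exact: exprn_continuous].
Qed.

Let cPs_s s theta : 0 <= theta <= pi / 2 -> {for s, continuous (Ps^~ theta)}.
Proof.
move=> h; have n0 := N_neq0 s h.
have c2 : {for s, continuous (fun x => expR x ^+ 2)}.
  by apply: (@continuous_comp _ _ _ expR (fun x => x ^+ 2)); [exact: continuous_expR|exact: exprn_continuous].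
apply: cvgM; last first.
  apply: cvgV; first by rewrite sqrf_eq0.
  by apply: (@continuous_comp _ _ _ (N^~ theta) (fun x => x ^+ 2)); last exact: exprn_continuous.
apply: cvgN; apply: cvgM; first exact: continuous_expR.
apply: cvgD; last by apply: cvgM; [exact: cvg_cst|exact: continuous_expR].
by apply: cvgM; [exact: cvg_cst|apply: cvgD => //; exact: cvg_cst].
Qed.

Let cw_s s theta : 0 <= theta <= pi / 2 -> {for s, continuous (w^~ theta)}.
Proof.
move=> h.
have cP : {for s, continuous (P^~ theta)}.
  by have [dd _] := dP_s s h; exact/differentiable_continuous/derivable1_diffP.
have cQ : {for s, continuous (Q^~ theta)}.
  by have [dd _] := dQ_s s h; exact/differentiable_continuous/derivable1_diffP.
have cQs := cQs_s (s := s) h; have cPs := cPs_s (s := s) h.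
apply: cvgM; first exact: continuous_expRM.
by apply: cvgB; [apply: cvgD; [apply: cvgD|]|]; apply: cvgM => //; exact: cvg_cst.
Qed.

Let mw : measurable_fun setT (fun z : R * R => w z.1 z.2).
Proof.
have m1 : measurable_fun setT (fun z : R * R => expR z.1) by exact: measurableT_comp.
have mc : measurable_fun setT (fun z : R * R => cos z.2).
  by apply: measurableT_comp => //; apply: continuous_measurable_fun; exact: continuous_cos.
have ms : measurable_fun setT (fun z : R * R => sin z.2).
  by apply: measurableT_comp => //; apply: continuous_measurable_fun; exact: continuous_sin.
have mca : measurable_fun setT (fun z : R * R => cos (alpha z.2)).
  by apply: (measurableT_comp (f := fun x => cos (alpha x))) => //; apply: continuous_measurable_fun => x; exact: ccos_alpha.
have msa : measurable_fun setT (fun z : R * R => sin (alpha z.2)).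
  by apply: (measurableT_comp (f := fun x => sin (alpha x))) => //; apply: continuous_measurable_fun => x; exact: csin_alpha.
have mN : measurable_fun setT (fun z : R * R => N z.1 z.2).
  apply: measurable_funD; last exact: measurable_funX.
  apply: measurable_funD => //; apply: measurable_funM => //.
  exact: measurable_funM.
have mNV : measurable_fun setT (fun z : R * R => (N z.1 z.2)^-1) by apply: measurableT_comp => //; exact: measurable_inv.
have mN2V : measurable_fun setT (fun z : R * R => (N z.1 z.2 ^+ 2)^-1).
  apply: (measurableT_comp measurable_inv); exact: measurable_funX.
apply: measurable_funM.
  by apply: (measurableT_comp (f := fun x => expR (t * x))) => //; exact: measurable_expRM.
have mP : measurable_fun setT (fun z : R * R => P z.1 z.2).
  by apply: measurable_funM => //; apply: measurable_funD => //; exact: measurable_funM.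
have mQ : measurable_fun setT (fun z : R * R => Q z.1 z.2).
  by apply: measurable_funM => //; exact: measurable_funM.
have mQs : measurable_fun setT (fun z : R * R => Qs z.1 z.2).
  apply: measurable_funM => //; apply: measurable_funM; first exact: measurable_funM.
  by apply: measurable_funB => //; exact: measurable_funX.
have mPs : measurable_fun setT (fun z : R * R => Ps z.1 z.2).
  apply: measurable_funM => //; apply: measurableT_comp => //; apply: measurable_funM => //.
  apply: measurable_funD; apply: measurable_funM => //.
  by apply: measurable_funD => //; exact: measurable_funX.
apply: measurable_funB; last exact: measurable_funM.
apply: measurable_funD; last exact: measurable_funM.
by apply: measurable_funD; apply: measurable_funM => //; exact: measurable_funM.
Qed.

Let ler_norm_div (a n : R) : 1 <= n -> `|a / n| <= `|a|.
Proof.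
move=> n1; rewrite normrM ler_piMr// ger0_norm ?invr_ge0 ?(le_trans _ n1)//.
by rewrite invf_le1// (lt_le_trans _ n1).
Qed.

Let P_le s theta : 0 <= theta <= pi / 2 -> `|P s theta| <= 1 + expR s.
Proof.
move=> h; rewrite (le_trans (ler_norm_div _ (N_ge1 s h)))// (le_trans (ler_normD _ _))//.
rewrite normr1 lerD2l normrM ger0_norm ?expR_ge0// ler_piMr ?expR_ge0//.
by rewrite ler_norml cos_geN1 cos_le1.
Qed.

Let Q_le s theta : 0 <= theta <= pi / 2 -> `|Q s theta| <= expR s.
Proof.
move=> h; rewrite (le_trans (ler_norm_div _ (N_ge1 s h)))//.
rewrite normrM ger0_norm ?expR_ge0// ler_piMr ?expR_ge0//.
by rewrite ler_norml sin_geN1 sin_le1.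
Qed.

Let Qs_le s theta : 0 <= theta <= pi / 2 -> `|Qs s theta| <= expR s * (1 + expR s ^+ 2).
Proof.
move=> h; rewrite (le_trans (ler_norm_div _ _)) ?exprn_ege1 ?N_ge1//.
rewrite !normrM ger0_norm ?expR_ge0// -mulrA ler_wpM2l ?expR_ge0//.
rewrite -[leRHS]mul1r ler_pM//.
  by rewrite ler_norml sin_geN1 sin_le1.
by rewrite (le_trans (ler_normB _ _))// normr1 ger0_norm ?sqr_ge0.
Qed.

Let Ps_le s theta : 0 <= theta <= pi / 2 -> `|Ps s theta| <= expR s * (1 + expR s ^+ 2 + 2 * expR s).
Proof.
move=> h; rewrite (le_trans (ler_norm_div _ _)) ?exprn_ege1 ?N_ge1//.
rewrite normrN !normrM ger0_norm ?expR_ge0// ler_wpM2l ?expR_ge0//.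
rewrite (le_trans (ler_normD _ _))// lerD//; last by rewrite ger0_norm ?mulr_ge0 ?expR_ge0.
rewrite normrM -[leRHS]mul1r ler_pM//.
  by rewrite ler_norml cos_geN1 cos_le1.
by rewrite ger0_norm ?addr_ge0 ?sqr_ge0.
Qed.

(** A crude bound of [|w|] for [s <= M], obtained by bounding sines, cosines, [t] and [1 / N] by 1.
    Added to [w], it makes the integrand nonnegative on a bounded rectangle, where Tonelli then
    applies. *)
Let K M := expR (t * M) * ((1 + expR M) + expR M + expR M * (1 + expR M ^+ 2) +
  expR M * (1 + expR M ^+ 2 + 2 * expR M)).

Let w_ge M s theta : s <= M -> 0 <= theta <= pi / 2 -> 0 <= w s theta + K M.
Proof.
move=> sM h; rewrite -lerBlDr sub0r.
suff : `|w s theta| <= K M by rewrite ler_norml => /andP[].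
have e : expR s <= expR M by rewrite ler_expR.
have s0 := expR_ge0 s.
have e2 : expR s ^+ 2 <= expR M ^+ 2 by rewrite lerXn2r ?nnegrE ?expR_ge0.
rewrite normrM ler_pM//; first by rewrite ger0_norm ?expR_ge0// ler_expR (ler_wpM2l (ltW t0)).
have sa : `|sin (alpha theta)| <= 1 by rewrite ler_norml sin_geN1 sin_le1.
have ca : `|cos (alpha theta)| <= 1 by rewrite ler_norml cos_geN1 cos_le1.
have t1' : `|t| <= 1 by rewrite ger0_norm ?ltW.
have M0 := expR_ge0 M.
rewrite (le_trans (ler_normB _ _))// lerD//; last first.
  rewrite normrM -[leRHS]mul1r ler_pM// (le_trans (Ps_le _ h))//.
  by rewrite ler_pM// ?addr_ge0 ?sqr_ge0 ?mulr_ge0// lerD ?lerD2l// ler_wpM2l.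
rewrite (le_trans (ler_normD _ _))// lerD//; last first.
  rewrite normrM -[leRHS]mul1r ler_pM// (le_trans (Qs_le _ h))//.
  by rewrite ler_pM// ?addr_ge0 ?sqr_ge0// lerD2l.
rewrite (le_trans (ler_normD _ _))// lerD//.
  rewrite normrM -[leRHS]mul1r ler_pM//; last by rewrite (le_trans (P_le _ h))// lerD2l.
  by rewrite normrM normrN mulr_ile1.
rewrite normrM -[leRHS]mul1r ler_pM//; last by rewrite (le_trans (Q_le _ h)).
by rewrite normrM mulr_ile1.
Qed.

Let A s := expR (t * s) / (1 + expR s ^+ 2).
Let B s := expR (t * s) / (1 + expR s).

Let cA : continuous A.
Proof.
move=> s; apply: cvgM; first exact: continuous_expRM.
apply: cvgV; first by rewrite gt_eqF// ltr_pwDl// sqr_ge0.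
apply: cvgD; first exact: cvg_cst.
by apply: (@continuous_comp _ _ _ expR (fun x => x ^+ 2)); [exact: continuous_expR|exact: exprn_continuous].
Qed.

Let cB : continuous B.
Proof.
move=> s; apply: cvgM; first exact: continuous_expRM.
apply: cvgV; first by rewrite gt_eqF// ltr_pwDl// expR_ge0.
by apply: cvgD; [exact: cvg_cst|exact: continuous_expR].
Qed.

Let U_pihalf s : U s (pi / 2) = A s.
Proof.
rewrite /U /alpha subrr mulr0 cos0 sin0 mul1r mul0r addr0 /P /N cos_pihalf.
by rewrite !mulr0 !addr0 mul1r.
Qed.

Let U_0 s : U s 0 = cos (t * (pi / 2)) * B s.
Proof.
rewrite /U /Q sin0 mulr0 mul0r mulr0 addr0 /P /N cos0 /alpha sub0r mulrN cosN /B.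
have e : 1 + expR s != 0 by rewrite gt_eqF// ltr_pwDl// expR_ge0.
have e2 : 1 + 2 * expR s * 1 + expR s ^+ 2 != 0.
  rewrite (_ : _ + _ = (1 + expR s) ^+ 2); last by ring.
  by rewrite sqrf_eq0.
by field; rewrite e mulr1 in e2 *; rewrite e2.
Qed.

Let V_le s theta : 0 <= theta <= pi / 2 ->
  `|V s theta| <= expR (t * s) * ((1 + 2 * expR s) / (1 + expR s ^+ 2)).
Proof.
move=> h; rewrite normrM ger0_norm ?expR_ge0// ler_wpM2l ?expR_ge0//.
have Nd a : `|a / N s theta| <= `|a| / (1 + expR s ^+ 2).
  rewrite normrM ler_wpM2l// ger0_norm ?invr_ge0 ?(le_trans _ (N_ge1 s h))//.
  rewrite lef_pV2 ?posrE; first exact: N_ge.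
    by rewrite (lt_le_trans _ (N_ge1 s h)).
  by rewrite ltr_pwDl ?sqr_ge0.
have D0 : 0 <= (1 + expR s ^+ 2)^-1 by rewrite invr_ge0 addr_ge0 ?sqr_ge0.
have c1 : `|cos theta| <= 1 by rewrite ler_norml cos_geN1 cos_le1.
have s1 : `|sin theta| <= 1 by rewrite ler_norml sin_geN1 sin_le1.
rewrite (le_trans (ler_normB _ _))//.
rewrite (_ : 1 + 2 * expR s = (1 + expR s) + expR s); last by ring.
rewrite [leRHS]mulrDl lerD//.
  rewrite normrM -[leRHS]mul1r ler_pM//.
    by rewrite ler_norml sin_geN1 sin_le1.
  rewrite (le_trans (Nd _))// ler_wpM2r// (le_trans (ler_normD _ _))// normr1 lerD2l.
  by rewrite normrM ger0_norm ?expR_ge0// ler_piMr ?expR_ge0.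
rewrite normrM -[leRHS]mul1r ler_pM//.
  by rewrite ler_norml cos_geN1 cos_le1.
rewrite (le_trans (Nd _))// ler_wpM2r//.
by rewrite normrM ger0_norm ?expR_ge0// ler_piMr ?expR_ge0.
Qed.

(** The contribution of the sides [s = - M] and [s = M] of the rectangle: the first bound decays
    because [0 < t], the second because [t < 1]. *)
Let V_leM M theta : 0 <= M -> 0 <= theta <= pi / 2 ->
  `|V (- M) theta - V M theta| <= 3 * expR (- t * M) + 3 * expR (- (1 - t) * M).
Proof.
move=> M0 h; rewrite (le_trans (ler_normB _ _))// lerD// (le_trans (V_le _ h))//.
  rewrite mulrN -mulNr mulrC ler_wpM2r ?expR_ge0//.
  rewrite ler_pdivrMr ?ltr_pwDl ?sqr_ge0//.
  have : expR (- M) <= 1 by rewrite -expR0 ler_expR oppr_le0.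
  by have := sqr_ge0 (expR (- M)); lra.
rewrite (_ : - (1 - t) * M = t * M + - M); last by ring.
rewrite expRD [leRHS]mulrCA ler_wpM2l ?expR_ge0// ler_pdivrMr ?ltr_pwDl ?sqr_ge0//.
rewrite expRN -mulrA mulrCA ler_pdivlMl ?expR_gt0//.
have := sqr_ge0 (expR M - 1 / 2); have := sqr_ge0 (expR M); lra.
Qed.

(** The integral of [w + K M] over the rectangle is computed in both orders: along [theta] it gives
    the increment of [U], along [s] that of [- V]. The two contributions of [K M] cancel at the
    end. *)
Let rotation_segment M : 0 < M ->
  `|\int[mu]_(s in `[- M, M]) A s - cos (t * (pi / 2)) * \int[mu]_(s in `[- M, M]) B s|
  <= (3 * expR (- t * M) + 3 * expR (- (1 - t) * M)) * (pi / 2).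
Proof.
move=> M0; set kappa := cos _; set beta := (X in X * (pi / 2)).
have p0 : 0 < pi / 2 :> R by rewrite divr_gt0 ?pi_gt0.
have MM : - M < M by rewrite (lt_trans _ M0)// oppr_lt0.
have E : (\int[mu]_(s in `[(- M)%R, M%R]) (A s + (K M * (pi / 2) - kappa * B s))%:E =
          \int[mu]_(theta in `[0%R, (pi / 2)%R]) (V (- M) theta - V M theta + 2 * M * K M)%:E)%E.
  transitivity (\int[mu]_(s in `[(- M)%R, M%R])
      \int[mu]_(theta in `[0%R, (pi / 2)%R]) (w s theta + K M)%:E)%E.
    apply: eq_integral => s _.
    have dF theta : 0 <= theta <= pi / 2 ->
        is_derive theta 1 (fun x => U s x + K M * x) (w s theta + K M).
      move=> h; have dd := dU s h.
      by apply: trigger_derive; rewrite /GRing.scale/=; ring.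
    rewrite (FTC_segment p0 _ dF); last first.
      by move=> theta h; apply: cvgD; [exact: cw_theta|exact: cvg_cst].
    by rewrite U_pihalf U_0; congr EFin; rewrite /kappa; ring.
  rewrite ge0_tonelli_on//; last 2 first.
  - by apply: measurable_funD.
  - move=> s theta; rewrite /= !in_itv/= => /andP[_ sM] h; exact: w_ge.
  apply: eq_integral => theta; rewrite inE/= in_itv/= => h.
  have dF s : - M <= s <= M ->
      is_derive s 1 (fun x => - V x theta + K M * x) (w s theta + K M).
    move=> _; have dd := dV s h.
    by apply: trigger_derive; rewrite /GRing.scale/=; ring.
  rewrite (FTC_segment MM _ dF); last first.
    by move=> s _; apply: cvgD; [exact: cw_s|exact: cvg_cst].
  by congr EFin; ring.
have iA : mu.-integrable `[- M, M] (EFin \o A).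
  by apply: segment_integrable => x _; exact: cA.
have iB : mu.-integrable `[- M, M] (EFin \o B).
  by apply: segment_integrable => x _; exact: cB.
have iBk : mu.-integrable `[- M, M] (EFin \o (fun s => kappa * B s)).
  by apply: segment_integrable => x _; apply: cvgM; [exact: cvg_cst|exact: cB].
have iK : mu.-integrable `[- M, M] (EFin \o (fun s => K M * (pi / 2))).
  by apply: segment_integrable => x _; exact: cvg_cst.
have iKB : mu.-integrable `[- M, M] (EFin \o (fun s => K M * (pi / 2) - kappa * B s)).
  apply: segment_integrable => x _; apply: cvgB; first exact: cvg_cst.
  by apply: cvgM; [exact: cvg_cst|exact: cB].
have cV s theta : 0 <= theta <= pi / 2 -> {for theta, continuous (V s)}.
  move=> h; apply: cvgM; first exact: cvg_cst.
  apply: cvgB; apply: cvgM => //; [exact: csin_alpha| |exact: ccos_alpha|].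
    by have [dd _] := dP_theta s h; exact/differentiable_continuous/derivable1_diffP.
  by have [dd _] := dQ_theta s h; exact/differentiable_continuous/derivable1_diffP.
have iV : mu.-integrable `[0, pi / 2] (EFin \o (fun theta => V (- M) theta - V M theta)).
  by apply: segment_integrable => x h; apply: cvgB; exact: cV.
have iK2 : mu.-integrable `[0, pi / 2] (EFin \o (fun theta : R => 2 * M * K M)).
  by apply: segment_integrable => x _; exact: cvg_cst.
have : \int[mu]_(s in `[- M, M]) (A s + (K M * (pi / 2) - kappa * B s)) =
    \int[mu]_(theta in `[0, pi / 2]) (V (- M) theta - V M theta + 2 * M * K M).
  by rewrite /Rintegral E.
have mD : measurable (`[- M, M]%classic : set (measurableTypeR R)) by exact: measurable_itv.
have mE : measurable (`[0, pi / 2]%classic : set (measurableTypeR R)) by exact: measurable_itv.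
have lD : fine (mu `[- M, M]) = 2 * M.
  by rewrite lebesgue_measure_itv/= lte_fin MM -EFinB/=; ring.
have lE : fine (mu `[0, pi / 2]) = pi / 2.
  by rewrite lebesgue_measure_itv/= lte_fin p0 -EFinB/= subr0.
have R1 : \int[mu]_(s in `[- M, M]) (A s + (K M * (pi / 2) - kappa * B s)) =
    \int[mu]_(s in `[- M, M]) A s + \int[mu]_(s in `[- M, M]) (K M * (pi / 2) - kappa * B s).
  exact: (RintegralD mD iA iKB).
have R2 : \int[mu]_(s in `[- M, M]) (K M * (pi / 2) - kappa * B s) =
    K M * (pi / 2) * (2 * M) - kappa * \int[mu]_(s in `[- M, M]) B s.
  rewrite (RintegralB mD iK iBk) (RintegralZl kappa mD iB) (Rintegral_cst _ mD).
  by congr (_ * _ - _); exact: lD.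
have R3 : \int[mu]_(theta in `[0, pi / 2]) (V (- M) theta - V M theta + 2 * M * K M) =
    \int[mu]_(theta in `[0, pi / 2]) (V (- M) theta - V M theta) + 2 * M * K M * (pi / 2).
  rewrite (RintegralD mE iV iK2) (Rintegral_cst _ mE).
  by congr (_ + _ * _); exact: lE.
rewrite R1 R2 R3.
move=> E'.
have -> : \int[mu]_(s in `[- M, M]) A s - kappa * \int[mu]_(s in `[- M, M]) B s =
    \int[mu]_(theta in `[0, pi / 2]) (V (- M) theta - V M theta) by lra.
rewrite (le_trans (le_normr_Rintegral mE iV))//.
rewrite (_ : beta * (pi / 2) = \int[mu]_(theta in `[0, pi / 2]) beta); last first.
  by rewrite (Rintegral_cst _ mE); congr (_ * _); exact/esym/lE.
apply: le_Rintegral => //.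
- apply: segment_integrable => x h.
  apply: (@continuous_comp _ _ _ (fun theta => V (- M) theta - V M theta) (fun x => `|x|)).
    by apply: cvgB; exact: cV.
  exact: norm_continuous.
- by apply: segment_integrable => x _; exact: cvg_cst.
- by move=> theta; rewrite /= in_itv/= => h; apply: V_leM => //; exact: ltW.
Qed.

Let B_N s : B (- s) = expR (- t * s) / (1 + expR (- s)).
Proof. by rewrite /B mulrN mulNr. Qed.

Let B_pos s : B s = expR (- (1 - t) * s) / (1 + expR (- s)).
Proof.
rewrite /B (_ : - (1 - t) * s = t * s - s); last by ring.
rewrite expRD expRN; field.
by rewrite !gt_eqF ?addr_gt0 ?expR_gt0.
Qed.

Let logistic_bounds s : 0 <= s -> 1 - expR (- s) <= (1 + expR (- s))^-1 <= 1.
Proof.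
move=> s0; have e0 : 0 < 1 + expR (- s) by rewrite ltr_pwDl ?expR_ge0.
rewrite invf_le1// lerDl expR_ge0 andbT -[leRHS]mul1r ler_pdivlMr//.
by have := sqr_ge0 (expR (- s)); lra.
Qed.

Let B_ge0 s : 0 <= B s.
Proof. by rewrite divr_ge0 ?addr_ge0 ?expR_ge0. Qed.

(** The half-line [s <= 0] contributes between [1 / t - 1 / (1 + t)] and [1 / t], and [s >= 0] at
    most [1 / (1 - t)]. Besides finiteness, what matters is that both bounds are equivalent to
    [1 / t] as [t] tends to 0. *)
Let integral_B_bounds : ((t^-1 - (1 + t)^-1)%:E <= \int[mu]_s (B s)%:E <= (t^-1 + (1 - t)^-1)%:E)%E.
Proof.
have u0 : 0 < 1 - t by rewrite subr_gt0.
have v0 : 0 < 1 + t by rewrite addr_gt0.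
have mB (D : set R) : measurable_fun D (fun s => (B s)%:E).
  by apply/measurable_EFinP/measurable_funTS; exact: continuous_measurable_fun.
have mBN (D : set R) : measurable_fun D (fun s => (B (- s))%:E).
  apply/measurable_EFinP/measurable_funTS; apply: measurableT_comp => //.
  exact: continuous_measurable_fun.
have EI a : 0 < a -> (\int[mu]_(s in `[0%R, +oo[) (expR (- a * s))%:E = a^-1%:E)%E.
  by move=> a0; rewrite integral_expRM_ray// mulr0 expR0 mul1r.
rewrite ge0_integralT_split//; apply/andP; split.
  rewrite -[leLHS]adde0 leeD//; last by apply: integral_ge0 => s _; rewrite lee_fin.
  rewrite EFinB leeBlDr// -!EI// -ge0_integralD//; do ?[
    by move=> s _; rewrite lee_fin ?expR_ge0|exact: measurable_EFin_expRM].
    apply: ge0_le_integral => //.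
    + exact: measurable_EFin_expRM.
    + by apply: emeasurable_funD; [exact: mBN|exact: measurable_EFin_expRM].
    move=> s; rewrite /= in_itv/= andbT => s0; rewrite -EFinD lee_fin B_N.
    have /andP[h _] := logistic_bounds s0.
    rewrite (_ : - (1 + t) * s = - t * s + - s); last by ring.
    rewrite expRD -lerBlDr -[X in X - _]mulr1 -mulrBr.
    by rewrite ler_wpM2l ?expR_ge0.
  exact: mBN.
rewrite EFinD -!EI// leeD//; apply: ge0_le_integral => //.
- by move=> s _; rewrite lee_fin.
- exact: mBN.
- exact: measurable_EFin_expRM.
- move=> s; rewrite /= in_itv/= andbT => s0; rewrite lee_fin B_N.
  by have /andP[_ h] := logistic_bounds s0; rewrite ler_piMr ?expR_ge0.
- by move=> s _; rewrite lee_fin.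
- exact: mB.
- exact: measurable_EFin_expRM.
- move=> s; rewrite /= in_itv/= andbT => s0; rewrite lee_fin B_pos.
  by have /andP[_ h] := logistic_bounds s0; rewrite ler_piMr ?expR_ge0.
Qed.

Lemma logistic_mellin_bounds : exists b : R,
  (\int[mu]_s (expR (t * s) / (1 + expR s))%:E = b%:E)%E /\
  t^-1 - (1 + t)^-1 <= b <= t^-1 + (1 - t)^-1.
Proof.
move: integral_B_bounds; rewrite /B; case: integral => [b| |]//=.
- by rewrite !lee_fin => ?; exists b.
- by rewrite leye_eq andbF.
Qed.

Lemma logistic_mellin_rotation :
  (\int[mu]_s (expR (t * s) / (1 + expR s ^+ 2))%:E =
   (cos (t * (pi / 2)))%:E * \int[mu]_s (expR (t * s) / (1 + expR s))%:E)%E.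
Proof.
have [b [Bb _]] := logistic_mellin_bounds; rewrite Bb -EFinM.
set kappa := cos _.
have fin_seg (F : R -> R) n : continuous F ->
    (\int[mu]_(s in `[(- n%:R)%R, n%:R%R]) (F s)%:E =
     (\int[mu]_(s in `[- n%:R, n%:R]) F s)%:E)%E.
  move=> cF; rewrite fineK//; apply: integrable_fin_num => //.
  by apply: segment_integrable => x _; exact: cF.
have mA : measurable_fun setT A by exact: continuous_measurable_fun.
have mB : measurable_fun setT B by exact: continuous_measurable_fun.
have A_ge0 s : 0 <= A s by rewrite divr_ge0 ?expR_ge0// addr_ge0 ?sqr_ge0.
have hA := ge0_integralT_lim mA A_ge0.
have hB := ge0_integralT_lim mB B_ge0.
have {}hB : \int[mu]_(s in `[- n%:R, n%:R]) B s @[n --> \oo] --> b.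
  apply: fine_cvg; move: hB; rewrite Bb.
  by under eq_fun do rewrite fin_seg//.
suff hA' : (\int[mu]_(s in `[(- n%:R)%R, n%:R%R]) (A s)%:E)%E @[n --> \oo] --> (kappa * b)%:E.
  exact: cvg_unique hA hA'.
under eq_fun do rewrite fin_seg//.
apply: cvg_EFin; first exact: nearW.
have -> : (fine \o (fun n => (\int[mu]_(s in `[- n%:R, n%:R]) A s)%:E)) =
    (fun n => (\int[mu]_(s in `[- n%:R, n%:R]) A s - kappa * \int[mu]_(s in `[- n%:R, n%:R]) B s)
     + kappa * \int[mu]_(s in `[- n%:R, n%:R]) B s).
  by apply/funext => n /=; rewrite subrK.
rewrite -[kappa * b]add0r; apply: cvgD; last exact: cvgMr.
rewrite -cvg_shiftS; apply: norm_cvg0.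
have e a : 0 < a -> expR (- a * n.+1%:R) @[n --> \oo] --> (0 : R).
  move=> a0; apply: (@cvg_comp _ _ _ (fun n : nat => n.+1%:R) (fun x => expR (- a * x)) _ (pinfty_nbhs R)).
    by have := @cvgr_idn R; rewrite -cvg_shiftS.
  exact: cvg_expRNy.
apply: (@squeeze_cvgr _ _ _ _ (cst 0) (fun n : nat => (3 * expR (- t * n.+1%:R) + 3 * expR (- (1 - t) * n.+1%:R)) * (pi / 2))).
- by apply: nearW => n; rewrite normr_ge0/= rotation_segment.
- exact: cvg_cst.
- rewrite -[X in _ --> X](mul0r (pi / 2)); apply: cvgM; last exact: cvg_cst.
  rewrite -[X in _ --> X](addr0 0); apply: cvgD; rewrite -[X in _ --> X](mulr0 3); apply: cvgMr; apply: e => //.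
  by rewrite subr_gt0.
Qed.

End rotation.

(** * Euler's reflection integral and the resolvent under the Cauchy law *)

Section reflection.
Context {R : realType}.
Local Notation mu := (@lebesgue_measure R).
Implicit Types t x c : R.

(** Dilating [s] by 2 turns the left integrand into twice the rotated one,
    [e^(t s) / (1 + e^(2 s))]. *)
Lemma logistic_mellin_half t : 0 < t -> t < 1 ->
  (\int[mu]_s (expR (t / 2 * s) / (1 + expR s))%:E =
   (2 * cos (t * (pi / 2)))%:E * \int[mu]_s (expR (t * s) / (1 + expR s))%:E)%E.
Proof.
move=> t0 t1; pose f s := expR (t / 2 * s) / (1 + expR s).
have cf : continuous f.
  move=> s; apply: cvgM; first exact: continuous_expRM.
  apply: cvgV; first by rewrite gt_eqF// ltr_pwDl// expR_ge0.
  by apply: cvgD; [exact: cvg_cst|exact: continuous_expR].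
rewrite (@integralT_affine _ f 2 0)//; last first.
  by move=> s; rewrite divr_ge0 ?addr_ge0 ?expR_ge0.
have mA : measurable_fun setT (fun s : R => (expR (t * s) / (1 + expR s ^+ 2))%:E).
  apply/measurable_EFinP/measurable_funM; first exact: measurable_expRM.
  apply: (measurableT_comp measurable_inv); apply: measurable_funD => //.
  exact: measurable_funX.
rewrite EFinM -muleA -logistic_mellin_rotation// -ge0_integralZl//.
apply: eq_integral => s _; rewrite -EFinM; congr EFin; congr (_ * _).
rewrite /f addr0; congr (expR _ / (1 + _)); first by field.
by rewrite -expRM_natl.
Qed.

(** The derivative of [sin (pi x)] at 0, read along a sequence. *)
Lemma cvg_sinc (u : nat -> R) : u n @[n --> \oo] --> (0 : R) -> (forall n, u n != 0) ->
  sin (pi * u n) / u n @[n --> \oo] --> (pi : R).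
Proof.
move=> u0 un0.
have D : is_derive (0 : R) 1 (fun x : R => sin (pi * x)) pi.
  apply: trigger_derive; rewrite /GRing.scale/= mulr0 cos0; ring.
have [/cvg_ex[/= l dl] dv] := D.
have lpi : l = pi.
  by rewrite -dv; apply/esym/cvg_lim => //.
rewrite lpi in dl.
move/cvgr_dnbhsP : dl => /(_ u (conj un0 u0)).
rewrite (_ : (fun n => _) = (fun n => sin (pi * u n) / u n))//.
apply/funext => n; rewrite /GRing.scale/= mulr1 addr0 mulr0 sin0 subr0; ring.
Qed.

(* Call [l t] the integral. By [logistic_mellin_half], [l t * sin (pi * t)] is
   invariant under [t -> t / 2], and [u * l u] tends to 1 as [u] tends to 0. *)
Lemma logistic_mellin t : 0 < t -> t < 1 ->
  (\int[mu]_s (expR (t * s) / (1 + expR s))%:E = (pi / sin (pi * t))%:E)%E.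
Proof.
move=> t0 t1; pose l u := fine (\int[mu]_s (expR (u * s) / (1 + expR s))%:E)%E.
have lE u : 0 < u -> u < 1 ->
    (\int[mu]_s (expR (u * s) / (1 + expR s))%:E = (l u)%:E)%E /\
    u^-1 - (1 + u)^-1 <= l u <= u^-1 + (1 - u)^-1.
  by move=> u0 u1; have [b [E h]] := logistic_mellin_bounds u0 u1; rewrite /l E.
pose u n := t * (2^-1) ^+ n.
have u0 n : 0 < u n by rewrite mulr_gt0// exprn_gt0// invr_gt0.
have u1 n : u n < 1.
  rewrite (le_lt_trans _ t1)// /u ler_piMr ?(ltW t0)// exprn_ile1// ?invr_ge0//.
  by rewrite invf_le1// ler1n.
have ucvg : u n @[n --> \oo] --> (0 : R).
  rewrite -[X in _ --> X](mulr0 t); apply: cvgMr; apply: cvg_expr.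
  by rewrite ger0_norm ?invr_ge0// invf_lt1// ltr1n.
(* With [x = u n * (pi / 2)], [sin (2 x) = 2 sin x cos x] absorbs the factor [2 cos x] of the
   halving formula. *)
have q n : l (u n) * sin (pi * u n) = l t * sin (pi * t).
  elim: n => [|n <-]; first by rewrite /u expr0 mulr1.
  have uS : u n.+1 = u n / 2 by rewrite /u exprSr mulrA.
  have E := logistic_mellin_half (u0 n) (u1 n).
  have h2 : 0 < u n / 2 by rewrite divr_gt0.
  have h3 : u n / 2 < 1 by rewrite ltr_pdivrMr// mul1r (lt_trans (u1 n))// ltr1n.
  have [E1 _] := lE _ (u0 n) (u1 n); have [E2 _] := lE _ h2 h3.
  rewrite E1 E2 -EFinM in E; case: E => E.
  rewrite uS E (_ : pi * u n = (u n * (pi / 2)) *+ 2); last by rewrite mulr2n; field.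
  rewrite (_ : pi * (u n / 2) = u n * (pi / 2)); last by ring.
  by rewrite sin_mulr2n; ring.
have lu n : 1 - u n <= u n * l (u n) <= 1 + u n / (1 - u n).
  have [_ /andP[h1 h2]] := lE _ (u0 n) (u1 n).
  have un := u0 n; have un1 : 0 < 1 - u n by rewrite subr_gt0.
  have un2 : 0 < 1 + u n by rewrite addr_gt0.
  apply/andP; split.
    apply: (@le_trans _ _ (u n * ((u n)^-1 - (1 + u n)^-1))); last by rewrite ler_pM2l.
    rewrite mulrBr divff ?gt_eqF// lerB// ler_piMr ?(ltW un)// invf_le1// lerDl (ltW un)//.
  apply: (@le_trans _ _ (u n * ((u n)^-1 + (1 - u n)^-1))); first by rewrite ler_pM2l.
  by rewrite mulrDr divff ?gt_eqF.
have ulcvg : u n * l (u n) @[n --> \oo] --> (1 : R).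
  apply: (@squeeze_cvgr _ _ _ _ (fun n => 1 - u n) (fun n => 1 + u n / (1 - u n))).
  - by apply: nearW => n; exact: lu.
  - by rewrite -[X in _ --> X](subr0 1); apply: cvgB => //; exact: cvg_cst.
  - rewrite -[X in _ --> X](addr0 1); apply: cvgD; first exact: cvg_cst.
    rewrite -[X in _ --> X](mul0r (1 - 0)^-1); apply: cvgM => //.
    apply: cvgV; first by rewrite subr0 oner_eq0.
    by apply: cvgB => //; exact: cvg_cst.
have key : l t * sin (pi * t) = pi.
  have un0 n : u n != 0 by rewrite gt_eqF.
  pose f n := u n * l (u n) * (sin (pi * u n) / u n).
  have H : f @ \oo --> 1 * pi by apply: cvgM => //; exact: cvg_sinc.
  have fE : f = cst (l t * sin (pi * t)).
    by apply/funext => n; rewrite /f /= -(q n); field.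
  rewrite fE mul1r in H.
  by apply: (cvg_unique _ (cvg_cst _) H).
have [-> _] := lE _ t0 t1; congr EFin.
have s0 : 0 < sin (pi * t).
  by rewrite sin_gt0_pi// mulr_gt0 ?pi_gt0//= gtr_pMr ?pi_gt0.
exact: (canRL (mulfK (lt0r_neq0 s0)) key).
Qed.

Lemma sin_pi_gt0 t : 0 < t -> t < 1 -> 0 < sin (pi * t).
Proof.
by move=> t0 t1; rewrite sin_gt0_pi// mulr_gt0 ?pi_gt0//= gtr_pMr ?pi_gt0.
Qed.

Lemma integral_sin_expR c :
  (\int[mu]_(t in `[0%R, 1%R]) (sin (pi * t) * expR (pi * t * c))%:E =
   (cauchy_pdf c * (1 + expR (pi * c)))%:E)%E.
Proof.
have p0 := pi_gt0 R.
have c0 : 0 < 1 + c ^+ 2 by rewrite ltr_pwDl ?sqr_ge0.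
(* The imaginary part of [e^(pi t (c + i)) / (pi (c + i))]. *)
pose F t := expR (pi * t * c) * (c * sin (pi * t) - cos (pi * t)) / (pi * (1 + c ^+ 2)).
have dF t : 0 <= t <= 1 -> is_derive t 1 F (sin (pi * t) * expR (pi * t * c)).
  move=> _; apply: trigger_derive; rewrite /GRing.scale/=.
  move: (@pi R) p0 => p p0; field.
  by rewrite !gt_eqF.
rewrite (FTC_segment ltr01 _ dF); last first.
  move=> t _; apply: cvgM.
    apply: (@continuous_comp _ _ _ (fun t => pi * t) sin); last exact: continuous_sin.
    exact: mulrl_continuous.
  rewrite (_ : (fun t => _) = (fun t => expR (pi * c * t))); last first.
    by apply/funext => z; congr expR; ring.
  rewrite (_ : pi * t * c = pi * c * t); last by ring.
  exact: continuous_expRM.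
congr EFin; rewrite /F /cauchy_pdf !mulr1 !mulr0 mul0r sinpi cospi sin0 cos0 expR0.
by move: (@pi R) p0 => p p0; field; rewrite !gt_eqF.
Qed.

(** The reflection integral under [s = pi c - b]: since [e^b = (x + 1) / x], the denominator
    [x + 1 + x e^(pi c)] is [(x + 1) (1 + e^s)]. *)
Lemma integral_expR_logistic t x : 0 < t -> t < 1 -> 0 < x ->
  (\int[mu]_c (expR (pi * t * c) / (x + 1 + x * expR (pi * c)))%:E =
   (expR (t * ln (1 + 1 / x)) / ((x + 1) * sin (pi * t)))%:E)%E.
Proof.
move=> t0 t1 x0; set b := ln _.
have p0 := pi_gt0 R.
have s0 := sin_pi_gt0 t0 t1.
have x1 : 0 < x + 1 by rewrite addr_gt0.
have eb : expR b = (x + 1) / x.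
  by rewrite lnK ?posrE ?addr_gt0 ?divr_gt0//; field; rewrite gt_eqF.
pose f s := expR (t * s) / (1 + expR s).
have cf : continuous f.
  move=> s; apply: cvgM; first exact: continuous_expRM.
  apply: cvgV; first by rewrite gt_eqF// ltr_pwDl// expR_ge0.
  by apply: cvgD; [exact: cvg_cst|exact: continuous_expR].
have := logistic_mellin t0 t1.
rewrite (@integralT_affine _ f pi (- b))//; last first.
  by move=> s; rewrite divr_ge0 ?addr_ge0 ?expR_ge0.
have E c : pi * f (pi * c + - b) = pi * expR (- (t * b)) * (x + 1) *
    (expR (pi * t * c) / (x + 1 + x * expR (pi * c))).
  rewrite /f (_ : t * (pi * c + - b) = - (t * b) + pi * t * c); last by ring.
  rewrite !expRD [expR (- b)]expRN eb; field.
  by rewrite !gt_eqF ?addr_gt0 ?mulr_gt0 ?expR_gt0.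
under eq_integral do rewrite E EFinM.
rewrite ge0_integralZl//; last 3 first.
- apply/measurable_EFinP; apply: continuous_measurable_fun => s.
  apply: cvgM; first exact: continuous_expRM.
  apply: cvgV; first by rewrite gt_eqF ?addr_gt0 ?mulr_gt0 ?expR_gt0.
  apply: cvgD; first exact: cvg_cst.
  by apply: cvgM; [exact: cvg_cst|exact: continuous_expRM].
- by move=> s _; rewrite lee_fin divr_ge0 ?addr_ge0 ?mulr_ge0 ?expR_ge0 ?ltW.
- by rewrite lee_fin !mulr_ge0 ?expR_ge0 ?ltW.
have k0 : pi * expR (- (t * b)) * (x + 1) != 0.
  by rewrite !mulf_neq0 ?gt_eqF ?expR_gt0.
move=> /(congr1 (fun z => (pi * expR (- (t * b)) * (x + 1))^-1%:E * z)%E).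
rewrite muleA -EFinM mulVf// mul1e => ->; rewrite -EFinM; congr EFin.
rewrite expRN.
move: (expR (t * b)) (expR_gt0 (t * b)) (sin (pi * t)) s0 => u u0 v v0.
by move: (@pi R) p0 => p p0; field; rewrite !gt_eqF.
Qed.

(** With [E = e^(pi c)], the integrand is the Cauchy density times [(1 + E) / (x + 1 + x E)]. Once
    the density times [1 + E] is replaced by its sine integral and the integrals are exchanged, the
    sine cancels that of the reflection formula, and the integral of [e^(b t) / (x + 1)] over [0, 1]
    remains. *)
Lemma cauchy_resolvent x : 0 < x ->
  (\int[mu]_c (cauchy_pdf c * (x + 1 / (1 + expR (pi * c)))^-1)%:E =
   (x * (x + 1) * ln (1 + 1 / x))^-1%:E)%E.
Proof.
move=> x0; have p0 := pi_gt0 R.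
have x1 : 0 < x + 1 by rewrite addr_gt0.
have e0 c : 0 < expR (pi * c) := expR_gt0 _.
have d0 c : 0 < x + 1 + x * expR (pi * c) by rewrite addr_gt0 ?mulr_gt0.
set b := ln _.
have eb : expR b = (x + 1) / x.
  by rewrite lnK ?posrE ?addr_gt0 ?divr_gt0//; field; rewrite gt_eqF.
have b0 : 0 < b by rewrite ln_gt0// ltrDl divr_gt0.
have msin : measurable_fun setT (fun t => sin (pi * t)).
  apply: continuous_measurable_fun => t.
  apply: (@continuous_comp _ _ _ (fun t => pi * t) sin); last exact: continuous_sin.
  exact: mulrl_continuous.
have mE : measurable_fun setT (fun z : R * R => expR (pi * z.2 * z.1)).
  by apply: measurableT_comp => //; apply: measurable_funM => //; exact: measurable_funM.
have md : measurable_fun setT (fun c => (x + 1 + x * expR (pi * c))^-1).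
  apply: (measurableT_comp measurable_inv); apply: measurable_funD => //.
  by apply: measurable_funM => //; exact: measurable_expRM.
have mst : measurable_fun setT (fun z : R * R => sin (pi * z.2) * expR (pi * z.2 * z.1) / (x + 1 + x * expR (pi * z.1))).
  apply: measurable_funM; last exact: (measurableT_comp md).
  by apply: measurable_funM => //; exact: (measurableT_comp msin).
(* The endpoints are removed because the reflection integral requires [0 < t < 1]. *)
have oo (f : R -> R) : measurable_fun setT f ->
    (\int[mu]_(t in `]0%R, 1%R[) (f t)%:E = \int[mu]_(t in `[0%R, 1%R]) (f t)%:E)%E.
  by move=> mf; rewrite (@integral_itv_bndoo R 0 1 _ true false)//;
    exact/measurable_EFinP/measurable_funTS.
transitivity (\int[mu]_(c in setT) \int[mu]_(t in `]0%R, 1%R[)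
    (sin (pi * t) * expR (pi * t * c) / (x + 1 + x * expR (pi * c)))%:E)%E.
  apply: eq_integral => c _.
  have mc : measurable_fun setT (fun t => sin (pi * t) * expR (pi * t * c)).
    apply: measurable_funM => //.
    rewrite (_ : (fun t => _) = (fun t => expR (pi * c * t))); first exact: measurable_expRM.
    by apply/funext => z; congr expR; ring.
  under eq_integral do rewrite mulrC EFinM.
  rewrite ge0_integralZl//; last 3 first.
  - by apply/measurable_EFinP; exact: measurable_funTS mc.
  - move=> t; rewrite /= in_itv/= => /andP[t0 t1].
    by rewrite lee_fin mulr_ge0 ?expR_ge0// ltW// sin_pi_gt0.
  - by rewrite lee_fin invr_ge0 ltW.
  rewrite oo// integral_sin_expR -EFinM; congr EFin.
  have {}e0 := e0 c; have {}d0 := d0 c.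
  move: (cauchy_pdf c) (expR (pi * c)) e0 d0 => p E E0 D0.
  have D1 : x * (1 + E) + 1 != 0 by rewrite gt_eqF// addr_gt0 ?mulr_gt0 ?addr_gt0.
  field.
  by rewrite (gt_eqF D0) gt_eqF ?addr_gt0.
rewrite ge0_tonelli_on//; last first.
  move=> c t _; rewrite /= in_itv/= => /andP[t0 t1].
  by rewrite divr_ge0 ?mulr_ge0 ?expR_ge0 ?(ltW (d0 _))// ltW// sin_pi_gt0.
transitivity (\int[mu]_(t in `]0%R, 1%R[) (expR (b * t) / (x + 1))%:E)%E.
  apply: eq_integral => t; rewrite inE/= in_itv/= => /andP[t0 t1].
  have s0 := sin_pi_gt0 t0 t1.
  under eq_integral do rewrite -mulrA EFinM.
  rewrite ge0_integralZl//; last 3 first.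
  - apply/measurable_EFinP; apply: measurable_funM => //; exact: measurable_expRM.
  - by move=> c _; rewrite lee_fin divr_ge0 ?expR_ge0 ?(ltW (d0 _)).
  - by rewrite lee_fin ltW.
  rewrite integral_expR_logistic// -EFinM; congr EFin; rewrite -/b [t * b]mulrC.
  by field; rewrite !gt_eqF.
rewrite oo; last by apply: measurable_funM => //; exact: measurable_expRM.
pose F t := expR (b * t) / (b * (x + 1)).
have dF t : 0 <= t <= 1 -> is_derive t 1 F (expR (b * t) / (x + 1)).
  move=> _; apply: trigger_derive; rewrite /GRing.scale/=; field.
  by rewrite !gt_eqF.
rewrite (FTC_segment ltr01 _ dF); last first.
  by move=> t _; apply: cvgM; [exact: continuous_expRM|exact: cvg_cst].
congr EFin; rewrite /F mulr1 mulr0 expR0 eb.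
by field; rewrite !gt_eqF.
Qed.

End reflection.

(** * The Levy exponent *)

Section laws.
Local Open Scope ereal_scope.
Context {R : realType}.

Lemma same_law_ge0_integral d1 d2 d3 (T1 : measurableType d1)
    (T2 : measurableType d2) (S : measurableType d3)
    (P1 : probability T1 R) (X1 : T1 -> S) (P2 : probability T2 R) (X2 : T2 -> S)
    (h : S -> \bar R) :
  same_law P1 X1 P2 X2 -> measurable_fun setT h -> (forall y, 0 <= h y) ->
  \int[P1]_w h (X1 w) = \int[P2]_w h (X2 w).
Proof.
move=> [mX1 mX2 X12] mh h0.
pose Y1 : {mfun T1 >-> S} := HB.pack X1 (isMeasurableFun.Build _ _ _ _ X1 mX1).
pose Y2 : {mfun T2 >-> S} := HB.pack X2 (isMeasurableFun.Build _ _ _ _ X2 mX2).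
transitivity (\int[distribution P1 Y1]_y h y).
  by rewrite ge0_integral_distribution.
rewrite (eq_measure_integral (distribution P2 Y2)); last first.
  by move=> A mA _; exact: X12.
by rewrite ge0_integral_distribution.
Qed.

Lemma has_density_ge0_integral d (T : measurableType d) (P : probability T R)
    (X : {RV P >-> R}) (f : R -> R) (h : R -> \bar R) :
  has_density X f -> (forall x, (0 <= f x)%R) -> measurable_fun setT f ->
  measurable_fun setT h -> (forall y, 0 <= h y) ->
  \int[P]_w h (X w) = \int[lebesgue_measure]_x ((f x)%:E * h x).
Proof.
move=> Xf f0 mf mh h0.
have <- := ge0_integral_density_measure lebesgue_measure f0 mf mh h0.
have mX : measurable_fun setT (X : T -> measurableTypeR R) by exact: (measurable_funPT X).
pose Y : {mfun T >-> measurableTypeR R} :=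
  HB.pack (X : T -> measurableTypeR R) (isMeasurableFun.Build _ _ _ _ _ mX).
transitivity (\int[distribution P Y]_y h y); first by rewrite ge0_integral_distribution.
by apply: eq_measure_integral => A mA _; exact: Xf.
Qed.

End laws.

Section cauchy_law.
Context {R : realType}.
Local Notation mu := (@lebesgue_measure R).

Lemma cauchy_pdf_ge0 (c : R) : 0 <= cauchy_pdf c.
Proof. by rewrite invr_ge0 mulr_ge0 ?pi_ge0// addr_ge0 ?sqr_ge0. Qed.

Lemma measurable_cauchy_pdf : measurable_fun setT (@cauchy_pdf R).
Proof.
apply: (measurableT_comp measurable_inv); apply: measurable_funM => //.
by apply: measurable_funD => //; exact: measurable_funX.
Qed.

Variables (d : measure_display) (T : measurableType d) (P : probability T R).
Variables (C : {RV P >-> R}) (C_cauchy : has_density C cauchy_pdf).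
Variables (d' : measure_display) (T' : measurableType d') (P' : probability T' R).
Variables (G0 : {RV P' >-> R}).
Hypothesis G0_law : same_law P' G0 P (fun w => 1 / (1 + expR (pi * C w))).

Definition logistic (c : R) : R := 1 / (1 + expR (pi * c)).

Lemma logistic01 c : 0 < logistic c < 1.
Proof.
have e0 := expR_gt0 (pi * c).
by rewrite /logistic div1r invr_gt0 invf_lt1 ?addr_gt0//= ltrDl.
Qed.

Lemma measurable_logistic : measurable_fun setT logistic.
Proof.
apply: measurable_funM => //; apply: (measurableT_comp measurable_inv).
by apply: measurable_funD => //; exact: measurable_expRM.
Qed.

Lemma levy_exponent_logistic (m l : R) : 0 < m -> 0 <= l ->
  (\int[mu]_(x in `]0%R, +oo[) ((1 - expR (- l * x))%:E *
      (x^-1%:E * 'E_P'[fun w => expR (- x * (m + G0 w))])) =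
   \int[P]_w (ln (1 + l / (m + logistic (C w))))%:E)%E.
Proof.
move=> m0 l0.
have mg : measurable_fun setT (fun w => logistic (C w)).
  exact: measurableT_comp measurable_logistic _.
transitivity (\int[mu]_(x in `]0%R, +oo[) \int[P]_(w in setT)
   ((1 - expR (- l * x)) / x * expR (- (m + logistic (C w)) * x))%:E)%E.
  apply: eq_integral => x; rewrite inE/= in_itv/= andbT => x0.
  have nn : 0 <= (1 - expR (- l * x)) / x.
    by rewrite divr_ge0 ?(ltW x0)// subr_ge0 -expR0 ler_expR mulNr oppr_le0 mulr_ge0 ?(ltW x0).
  have mE : measurable_fun setT (fun y => (expR (- x * (m + y)))%:E).
    by apply/measurable_EFinP; apply: measurableT_comp => //; apply: measurable_funM => //; exact: measurable_funD.
  rewrite unlock muleA -EFinM.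
  rewrite (same_law_ge0_integral G0_law mE); last by move=> y; rewrite lee_fin expR_ge0.
  rewrite -ge0_integralZl//; last exact: measurableT_comp mE mg.
  apply: eq_integral => w _; rewrite -EFinM; congr (_ * expR _)%:E.
  by rewrite /logistic; ring.
rewrite ge0_tonelli_on//; last 2 first.
- apply: measurable_funM.
    apply: measurable_funM; last exact: (measurableT_comp measurable_inv).
    apply: measurable_funB => //.
    by apply: (measurableT_comp (f := fun x => expR (- l * x))) => //; exact: measurable_expRM.
  apply: measurableT_comp => //; apply: measurable_funM => //.
  apply: measurableT_comp => //; apply: measurable_funD => //.
  exact: (measurableT_comp mg).
- move=> x w; rewrite /= in_itv/= andbT => x0 _.
  rewrite mulr_ge0 ?expR_ge0// divr_ge0 ?(ltW x0)// subr_ge0 -expR0 ler_expR.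
  by rewrite mulNr oppr_le0 mulr_ge0 ?(ltW x0).
apply: eq_integral => w _; rewrite frullani// addr_gt0//.
by have /andP[] := logistic01 (C w).
Qed.

Lemma expectation_resolvent_logistic x : 0 < x ->
  (\int[P]_w ((x + logistic (C w))^-1)%:E = ((x * (x + 1) * ln (1 + 1 / x))^-1)%:E)%E.
Proof.
move=> x0.
have mh : measurable_fun setT (fun c => ((x + logistic c)^-1)%:E).
  apply/measurable_EFinP/(measurableT_comp measurable_inv).
  by apply: measurable_funD => //; exact: measurable_logistic.
rewrite (has_density_ge0_integral C_cauchy cauchy_pdf_ge0 measurable_cauchy_pdf mh).
  by rewrite -cauchy_resolvent//; apply: eq_integral => c _; rewrite EFinM.
move=> y; have /andP[? _] := logistic01 y.
by rewrite lee_fin invr_ge0 addr_ge0// ltW.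
Qed.

(** The expected resolvent at [m + v] is a logarithmic derivative: with [L v = ln (1 + 1 / (m + v))]
    it equals [- L' / L], so its integral over [0, l] is an increment of [- ln L]. *)
Lemma expectation_ln_logistic (m l : R) : 0 < m -> 0 <= l ->
  (\int[P]_w (ln (1 + l / (m + logistic (C w))))%:E =
   (- ln (ln (1 + 1 / (l + m)) / ln (1 + 1 / m)))%:E)%E.
Proof.
move=> m0; rewrite le_eqVlt => /predU1P[<-|l0].
  rewrite add0r divff; last first.
    by rewrite gt_eqF// ln_gt0// ltrDl divr_gt0.
  by rewrite ln1 oppr0; apply: integral0_eq => w _; rewrite mul0r addr0 ln1.
have mg : measurable_fun setT (fun w => logistic (C w)).
  exact: measurableT_comp measurable_logistic _.
have g0 w : 0 < m + logistic (C w).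
  by have /andP[? _] := logistic01 (C w); rewrite addr_gt0.
transitivity (\int[P]_(w in setT) \int[mu]_(v in `[0%R, l])
    ((m + logistic (C w) + v)^-1)%:E)%E.
  by apply: eq_integral => w _; rewrite integral_inv_segment.
rewrite ge0_tonelli_on//; last 2 first.
- apply: (measurableT_comp measurable_inv); apply: measurable_funD => //.
  apply: (measurableT_comp (f := fun w => m + logistic (C w))) => //.
  exact: measurable_funD.
- by move=> w v _; rewrite /= in_itv/= => /andP[v0 _]; rewrite invr_ge0 addr_ge0// ltW.
pose L v := ln (1 + 1 / (m + v)).
have L0 (v : R) : 0 <= v -> 0 < L v.
  by move=> v0; rewrite ln_gt0// ltrDl divr_gt0// ltr_pwDl.
have dL (v : R) : 0 <= v -> is_derive v 1 L (- ((m + v) * (m + v + 1))^-1).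
  move=> v0; have mv : 0 < m + v by rewrite ltr_pwDl.
  have mv1 : m + v != 0 by rewrite gt_eqF.
  have p1 : 0 < 1 + 1 / (m + v) by rewrite addr_gt0// divr_gt0.
  have := is_derive1_ln p1 => H.
  apply: trigger_derive; rewrite /GRing.scale/=; field.
  by rewrite mv1 andbT gt_eqF// addr_gt0.
transitivity (\int[mu]_(v in `[0%R, l]) (((m + v) * (m + v + 1) * L v)^-1)%:E)%E.
  apply: eq_integral => v; rewrite inE/= in_itv/= => /andP[v0 _].
  rewrite -expectation_resolvent_logistic ?ltr_pwDl//.
  by apply: eq_integral => w _; congr (_^-1)%:E; ring.
have dF (v : R) : 0 <= v <= l -> is_derive v 1 (fun v => - ln (L v)) ((m + v) * (m + v + 1) * L v)^-1.
  move=> /andP[v0 _]; have dd := dL v v0; have ll := L0 v v0.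
  have := is_derive1_ln ll => H.
  apply: trigger_derive; rewrite /GRing.scale/=; field.
  have mv : 0 < m + v by rewrite ltr_pwDl.
  by rewrite (gt_eqF ll) (gt_eqF mv) andbT gt_eqF// addr_gt0.
rewrite (FTC_segment l0 _ dF).
  congr EFin; rewrite /L addr0 ln_div ?posrE.
  - by rewrite [l + m]addrC; ring.
  - by rewrite [l + m]addrC; exact: (L0 _ (ltW l0)).
  - by have := L0 0 (lexx 0); rewrite /L addr0.
move=> v /andP[v0 _]; have mv : 0 < m + v by rewrite ltr_pwDl.
apply: cvgV.
  by rewrite gt_eqF// mulr_gt0 ?L0// mulr_gt0// addr_gt0.
have cv : m + v0' @[v0' --> v] --> m + v by apply: cvgD; [exact: cvg_cst|exact: cvg_id].
apply: cvgM; first by apply: cvgM => //; apply: cvgD => //; exact: cvg_cst.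
by have [dd _] := dL v v0; exact/differentiable_continuous/derivable1_diffP.
Qed.

End cauchy_law.

(** * Identification of laws *)

Section weighted_law.
Local Open Scope ereal_scope.
Context {R : realType} d (T : measurableType d).

(** The assumption says that [nu] is the image under [X] of the measure with density [W]. This form
    allows one factor of an expected product to pass from an indicator to a general function. *)
Lemma ge0_integral_weighted d' (S : measurableType d') (m : {measure set T -> \bar R})
    (W : T -> R) (X : T -> S) (nu : {measure set S -> \bar R}) (h : S -> \bar R) :
  (forall w, (0 <= W w)%R) -> measurable_fun setT W -> measurable_fun setT X ->
  (forall B, measurable B -> \int[m]_(w in X @^-1` B) (W w)%:E = nu B) ->
  measurable_fun setT h -> (forall y, 0 <= h y) ->
  \int[m]_w ((W w)%:E * h (X w)) = \int[nu]_y h y.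
Proof.
move=> W0 mW mX E mh h0.
pose Y : {mfun T >-> S} := HB.pack X (isMeasurableFun.Build _ _ _ _ X mX).
rewrite -(ge0_integral_density_measure m W0 mW) => [| |w]; last 2 first.
- exact: measurableT_comp mh mX.
- exact: h0.
transitivity (\int[pushforward (density_measure m W0 mW) Y]_y h y).
  by rewrite ge0_integral_pushforward.
by apply: eq_measure_integral => B mB _; exact: E.
Qed.

End weighted_law.

Section laplace_laws.
Context {R : realType}.
Local Notation mu := (@lebesgue_measure R).
Local Notation D := (`[0%R, +oo[%classic : set R).

(** [mfrestr] on the whole space turns a bound on the total mass into the finite-measure structure
    that [laplace_measure_unique] expects. *)
Lemma laplace_fin_measure_unique (m1 m2 : {measure set (measurableTypeR R) -> \bar R}) :
  (m1 setT < +oo)%E -> (m2 setT < +oo)%E ->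
  m1 `]-oo, 0[%classic = 0%E -> m2 `]-oo, 0[%classic = 0%E ->
  (forall n : nat, \int[m1]_(x in D) (expR (- n%:R * x))%:E =
                   \int[m2]_(x in D) (expR (- n%:R * x))%:E)%E ->
  forall A : set R, measurable A -> m1 A = m2 A.
Proof.
move=> f1 f2 z1 z2 m12 A mA.
have mI (m : {measure set (measurableTypeR R) -> \bar R}) (fm : (m setT < +oo)%E) B :
    mfrestr measurableT fm B = m B by rewrite /mfrestr /mrestr setIT.
have iI (m : {measure set (measurableTypeR R) -> \bar R}) (fm : (m setT < +oo)%E) n :
    (\int[mfrestr measurableT fm]_(x in D) (expR (- n%:R * x))%:E =
     \int[m]_(x in D) (expR (- n%:R * x))%:E)%E.
  by apply: eq_measure_integral => B mB _; exact: mI.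
rewrite -(mI m1 f1) -(mI m2 f2); apply: laplace_measure_unique => //.
- exact: (eq_trans (mI _ _ _)).
- exact: (eq_trans (mI _ _ _)).
- by move=> n; apply: (eq_trans (iI _ _ _)); rewrite m12; exact/esym/iI.
Qed.

Lemma measure_laplace_law d (T : measurableType d) (P : probability T R) (X : T -> R)
    (nu : {measure set (measurableTypeR R) -> \bar R}) :
  measurable_fun setT X -> (forall w, 0 <= X w) ->
  (nu setT < +oo)%E -> nu `]-oo, 0[%classic = 0%E ->
  (forall n : nat, \int[P]_w (expR (- n%:R * X w))%:E =
                   \int[nu]_(x in D) (expR (- n%:R * x))%:E)%E ->
  forall A : set R, measurable A -> P (X @^-1` A) = nu A.
Proof.
move=> mX X0 nufin nu0 E A mA.
have mX' : measurable_fun setT (X : T -> measurableTypeR R) by exact: mX.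
pose Y : {mfun T >-> measurableTypeR R} :=
  HB.pack (X : T -> measurableTypeR R) (isMeasurableFun.Build _ _ _ _ _ mX').
have preD : Y @^-1` D = setT.
  by apply/seteqP; split => // w _ /=; rewrite in_itv/= X0.
apply: (@laplace_fin_measure_unique (pushforward P Y) nu) => //.
- apply: (@le_lt_trans _ _ 1%E); last exact: ltry.
  exact: (probability_le1 (distribution P Y) measurableT).
- change (P (Y @^-1` `]-oo, 0[%classic) = 0%E).
  rewrite (_ : _ @^-1` _ = set0) ?measure0//.
  by rewrite -subset0 => w /=; rewrite in_itv/= ltNge X0.
move=> n; rewrite -E.
have mE : measurable_fun setT (fun x : measurableTypeR R => (expR (- n%:R * x))%:E).
  exact: measurable_EFin_expRM.
rewrite ge0_integral_pushforward//.
- by rewrite preD.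
- exact: measurable_funTS mE.
Qed.

Lemma same_law_laplace d1 d2 (T1 : measurableType d1) (T2 : measurableType d2)
    (P1 : probability T1 R) (P2 : probability T2 R) (X1 : T1 -> R) (X2 : T2 -> R) :
  measurable_fun setT X1 -> measurable_fun setT X2 ->
  (forall w, 0 <= X1 w) -> (forall w, 0 <= X2 w) ->
  (forall n : nat, \int[P1]_w (expR (- n%:R * X1 w))%:E =
                   \int[P2]_w (expR (- n%:R * X2 w))%:E)%E ->
  forall A : set R, measurable A -> P1 (X1 @^-1` A) = P2 (X2 @^-1` A).
Proof.
move=> mX1 mX2 X10 X20 E A mA.
have mX' : measurable_fun setT (X2 : T2 -> measurableTypeR R) by exact: mX2.
pose Y : {mfun T2 >-> measurableTypeR R} :=
  HB.pack (X2 : T2 -> measurableTypeR R) (isMeasurableFun.Build _ _ _ _ _ mX').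
have preD : Y @^-1` D = setT.
  by apply/seteqP; split => // w _ /=; rewrite in_itv/= X20.
apply: (@measure_laplace_law _ _ P1 X1 (pushforward P2 Y)) => //.
- apply: (@le_lt_trans _ _ 1%E); last exact: ltry.
  exact: (probability_le1 (distribution P2 Y) measurableT).
- change (P2 (Y @^-1` `]-oo, 0[%classic) = 0%E).
  rewrite (_ : _ @^-1` _ = set0) ?measure0//.
  by rewrite -subset0 => w /=; rewrite in_itv/= ltNge X20.
move=> n; rewrite E.
have mE : measurable_fun setT (fun x : measurableTypeR R => (expR (- n%:R * x))%:E).
  exact: measurable_EFin_expRM.
rewrite ge0_integral_pushforward//.
- by rewrite preD.
- exact: measurable_funTS mE.
Qed.

Lemma density_laplace_law d (T : measurableType d) (P : probability T R) (X : T -> R)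
    (f : R -> R) :
  measurable_fun setT X -> (forall w, 0 <= X w) ->
  (forall x, 0 <= f x) -> measurable_fun setT f -> (forall x, x < 0 -> f x = 0) ->
  (forall n : nat, \int[P]_w (expR (- n%:R * X w))%:E =
                   \int[mu]_x (f x * expR (- n%:R * x))%:E)%E ->
  forall A : set R, measurable A -> P (X @^-1` A) = (\int[mu]_(x in A) (f x)%:E)%E.
Proof.
move=> mX X0 f0 mf fN E A mA.
apply: (@measure_laplace_law _ _ P X (density_measure mu f0 mf)) => //.
(* At [n = 0] the assumption says that [f] has total mass 1. *)
- have := E 0%N; under eq_integral do rewrite oppr0 mul0r expR0.
  rewrite [LHS](_ : _ = 1%E); last by rewrite integral_cst//= mul1e probability_setT.
  under eq_integral do rewrite oppr0 mul0r expR0 mulr1.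
  by move=> E0; apply: (@le_lt_trans _ _ 1%E); [rewrite E0|exact: ltry].
- apply: integral0_eq => x; rewrite /= in_itv/= => x0.
  by rewrite fN.
move=> n; rewrite E [RHS]integral_mkcond.
rewrite [RHS]ge0_integral_density_measure; last 2 first.
- have mD : measurable (D : set (measurableTypeR R)) by exact: measurable_itv.
  by apply/(measurable_restrictT _ mD); exact: measurable_EFin_expRM.
- by move=> x; rewrite patchE; case: ifP => // _; rewrite lee_fin expR_ge0.
apply: eq_integral => x _; rewrite patchE; case: ifPn => xD; first by rewrite EFinM.
rewrite fN ?mul0r ?mul0e//; move: xD; rewrite notin_setE/= in_itv/= andbT.
by move/negP; rewrite -ltNge.
Qed.

End laplace_laws.

(** * Expectation of a product of independent factors *)

Section independence.
Local Open Scope ereal_scope.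
Context {R : realType} d (T : measurableType d) (P : probability T R).

(* Induction on the number of factors [f i] that are not indicators. *)
Lemma mutually_independent_expectation n (X : 'I_n -> T -> R) (f : 'I_n -> R -> R) :
  mutually_independent P X -> (forall i, measurable_fun setT (X i)) ->
  (forall i, measurable_fun setT (f i)) -> (forall i x, (0 <= f i x <= 1)%R) ->
  \int[P]_w (\prod_(i < n) f i (X i w))%:E = \prod_(i < n) \int[P]_w (f i (X i w))%:E.
Proof.
move=> indX mX.
(* The factors of index at least [k] are indicators; the case [k = n] imposes nothing. *)
suff H k (g : 'I_n -> R -> R) : (forall i, measurable_fun setT (g i)) ->
    (forall i x, (0 <= g i x <= 1)%R) ->
    (forall i : 'I_n, (k <= i)%N -> exists2 B, measurable B & g i = \1_B) ->
    \int[P]_w (\prod_(i < n) g i (X i w))%:E = \prod_(i < n) \int[P]_w (g i (X i w))%:E.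
  by move=> mf f01; apply: (H n) => // i; rewrite leqNgt ltn_ord.
have pind i B : measurable B -> P (X i @^-1` B) = \int[P]_w (\1_B (X i w))%:E.
  move=> mB; have mXB : measurable (X i @^-1` B).
    by rewrite -[X in measurable X]setTI; exact: mX.
  transitivity (\int[P]_w (\1_(X i @^-1` B) w)%:E); first by rewrite integral_indic ?setIT.
  by apply: eq_integral => w _; rewrite !indicE.
move: k g; have mprod (g : 'I_n -> R -> R) (Q : pred 'I_n) : (forall i, measurable_fun setT (g i)) ->
    measurable_fun setT (fun w => \prod_(i < n | Q i) g i (X i w))%R.
  move=> mg; under eq_fun do rewrite big_mkcond.
  apply: measurable_prod => i _; case: (Q i) => //.
  exact: measurableT_comp (mg i) (mX i).
elim=> [|k IH] {}f mf f01 fB.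
  have [B HB] : exists B : 'I_n -> set R, forall i, measurable (B i) /\ f i = \1_(B i).
    have : forall i, exists Bi : set R, measurable Bi /\ f i = \1_Bi.
      by move=> i; have [Bi ? ?] := fB i (leq0n _); exists Bi.
    by move=> /choice[B HB]; exists B.
  have mXB i : measurable (X i @^-1` B i).
    by rewrite -[X in measurable X]setTI; apply: mX => //; have [] := HB i.
  have E : (fun w => \prod_(i < n) f i (X i w))%R = \1_(\bigcap_(i in [set: 'I_n]) (X i @^-1` B i)).
    apply/funext => w; rewrite indicE.
    have [wB|wB] := boolP (_ \in _).
      rewrite big1// => i _; have [_ ->] := HB i; rewrite indicE mem_set//.
      by move: wB; rewrite inE => /(_ i I).
    have [i Hi] : exists i, ~ (X i @^-1` B i) w.
      apply/existsNP => H; move: wB; rewrite notin_setE; apply => i _; exact: H.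
    rewrite (bigD1 i)//= (_ : f i _ = 0%R) ?mul0r//.
    by have [_ ->] := HB i; rewrite indicE memNset.
  under eq_integral do rewrite (congr1 (fun g => g _) E).
  rewrite integral_indic//; last by apply: fin_bigcap_measurable => // i _; exact: mXB.
  rewrite setIT; apply: (eq_trans (indX B _)); first by move=> i; have [] := HB i.
  apply: eq_bigr => i _; have [mBi ->] := HB i.
  exact: pind.
have [kn|nk] := ltnP k n; last first.
  apply: IH => // i ki; have := ltn_ord i.
  by rewrite ltnNge (leq_trans nk ki).
pose k0 : 'I_n := Ordinal kn.
pose W w := (\prod_(i < n | i != k0) f i (X i w))%R.
have W0 w : (0 <= W w)%R by apply: prodr_ge0 => i _; have /andP[] := f01 i (X i w).
have mW : measurable_fun setT W by exact: mprod.
pose p i := \int[P]_w (f i (X i w))%:E.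
have p01 i : 0 <= p i <= 1.
  apply/andP; split.
    by apply: integral_ge0 => w _; rewrite lee_fin; have /andP[] := f01 i (X i w).
  rewrite (_ : 1 = \int[P]_w 1); last by rewrite integral_cst//= mul1e probability_setT.
  apply: ge0_le_integral => //.
  - by move=> w _; rewrite lee_fin; have /andP[] := f01 i (X i w).
  - by apply/measurable_EFinP; exact: measurableT_comp (mf i) (mX i).
  - by move=> w _; rewrite lee_fin; have /andP[] := f01 i (X i w).
have pfin i : p i = (fine (p i))%:E.
  by rewrite fineK// ge0_fin_numE; have /andP[h0 h1] := p01 i => //; rewrite (le_lt_trans h1)// ltry.
pose c := (\prod_(i < n | i != k0) fine (p i))%R.
have c0 : (0 <= c)%R.
  by apply: prodr_ge0 => i _; rewrite fine_ge0//; have /andP[] := p01 i.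
(* With [f k0] replaced by the indicator of [B], the induction hypothesis says that the law of
   [X k0] weighted by the other factors is [c] times the law of [X k0]; [f k0] is then integrated
   against it. *)
have key B : measurable B -> \int[P]_(w in X k0 @^-1` B) (W w)%:E =
    c%:E * P (X k0 @^-1` B).
  move=> mB.
  pose f' i := if i == k0 then \1_B : R -> R else f i.
  have f'k : f' k0 = \1_B by rewrite /f' eqxx.
  have f'N i : i != k0 -> f' i = f i by rewrite /f' => /negbTE ->.
  have := IH f'; rewrite [X in _ -> _ -> _ -> _ = X](bigD1 k0)//= f'k.
  rewrite (_ : \int[P]_w (\1_B (X k0 w))%:E = P (X k0 @^-1` B)); last first.
    exact/esym/pind.
  rewrite (_ : \prod_(i < n | i != k0) _ = c%:E); last first.
    by rewrite /c -prodEFin; apply: eq_bigr => i ik; rewrite f'N// -pfin.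
  rewrite muleC => <-.
  - rewrite integral_mkcond; apply: eq_integral => w _; rewrite patchE.
    rewrite (bigD1 k0)//= f'k indicE; case: ifPn => wB.
      rewrite mem_set ?mul1r; last by move: wB; rewrite inE.
      by congr EFin; apply: eq_bigr => i ik; rewrite f'N.
    by rewrite memNset ?mul0r//; move: wB; rewrite notin_setE.
  - by move=> i; have [->|ik] := eqVneq i k0; [rewrite f'k|rewrite f'N].
  - move=> i x; have [->|ik] := eqVneq i k0; last by rewrite f'N.
    by rewrite f'k indicE; case: (_ \in _); rewrite ?lexx ?ler01.
  - move=> i ki; have [->|ik] := eqVneq i k0; first by rewrite f'k; exists B.
    rewrite f'N//; apply: fB; rewrite ltn_neqAle ki andbT.
    by apply: contra ik => /eqP ki'; apply/eqP/val_inj.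
transitivity (\int[P]_w ((W w)%:E * (f k0 (X k0 w))%:E)).
  by apply: eq_integral => w _; rewrite -EFinM (bigD1 k0)//= mulrC.
pose cn := NngNum c0.
pose Y : {mfun T >-> R} := HB.pack (X k0) (isMeasurableFun.Build _ _ _ _ _ (mX k0)).
rewrite (@ge0_integral_weighted _ _ _ _ _ P W (X k0) (mscale cn (distribution P Y)) (fun x => (f k0 x)%:E))//.
- rewrite ge0_integral_mscale//.
  + rewrite ge0_integral_distribution//; last 2 first.
    * exact/measurable_EFinP.
    * by move=> y; rewrite lee_fin; have /andP[] := f01 k0 y.
    rewrite (bigD1 k0)//= muleC; congr (_ * _).
    rewrite /c -prodEFin; apply: eq_bigr => i _; exact/esym/pfin.
  + exact/measurable_EFinP.
  + by move=> y _; rewrite lee_fin; have /andP[] := f01 k0 y.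
- exact/measurable_EFinP.
- by move=> y; rewrite lee_fin; have /andP[] := f01 k0 y.
Qed.

End independence.

(** * Riemann sums and the cotangent substitution *)

Section riemann_stieltjes.
Local Open Scope ereal_scope.
Context {R : realType}.
Variables (m : {measure set (measurableTypeR R) -> \bar R}) (t : R) (t0 : (0 < t)%R).
Implicit Types (n i : nat) (u : R) (h : R -> R).

Definition grid n i : R := (t * (i%:R / n.+1%:R))%R.

Lemma grid0 n : grid n 0 = 0%R.
Proof. by rewrite /grid mul0r mulr0. Qed.

Lemma gridn n : grid n n.+1 = t.
Proof. by rewrite /grid divff ?mulr1// pnatr_eq0. Qed.

Lemma le_grid n i j : (i <= j)%N -> (grid n i <= grid n j)%R.
Proof. by move=> ij; rewrite ler_pM2l// ler_pM2r ?invr_gt0// ler_nat. Qed.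

Lemma gridS n i : grid n i.+1 = (grid n i + t / n.+1%:R)%R.
Proof. by rewrite /grid -natr1 mulrDl mul1r mulrDr. Qed.

(* Sampling at right endpoints gives [step_sum h n t = h t] exactly, so that no
   continuity is needed at [t], where [h] may be singular. *)
Definition step_sum h n u : R :=
  (\sum_(i < n.+1) h (grid n i.+1) * \1_(`]grid n i, grid n i.+1]) u)%R.

Lemma step_sumE h n u : (0 < u <= t)%R ->
  exists2 v, (u <= v <= t)%R /\ (v <= u + t / n.+1%:R)%R & step_sum h n u = h v.
Proof.
move=> /andP[u0 ut].
have ex : exists i, (u <= grid n i)%R by exists n.+1; rewrite gridn.
(* The least grid point at or above [u] is the right end of the cell that contains [u]. *)
case: (ex_minnP ex) => -[|i] ui imin; first by move: ui; rewrite grid0 leNgt u0.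
have iu : (grid n i < u)%R by rewrite ltNge; apply/negP => /imin; rewrite ltnn.
have in_ : (i < n.+1)%N.
  rewrite ltnNge; apply/negP => /(le_grid n); rewrite gridn.
  by rewrite leNgt (lt_le_trans iu ut).
exists (grid n i.+1).
  split; first by rewrite ui/= -(gridn n) le_grid.
  by rewrite gridS lerD2r ltW.
rewrite /step_sum (bigD1 (Ordinal in_))//= big1 ?addr0.
  by rewrite indicE mem_set ?mulr1//= in_itv/= iu.
move=> j ji; rewrite indicE memNset ?mulr0//= in_itv/=.
have {}ji : (j : nat) != i by apply: contra ji => /eqP ji; apply/eqP/val_inj.
move=> /andP[ju uj]; move: ji; rewrite neq_ltn => /orP[|] ji.
  by have := lt_le_trans iu (le_trans uj (le_grid n ji)); rewrite ltxx.
by have := lt_le_trans ju (le_trans ui (le_grid n ji)); rewrite ltxx.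
Qed.

Lemma cvg_step_sum h u : {in `]0%R, t[, continuous h} -> (0 < u <= t)%R ->
  step_sum h n u @[n --> \oo] --> h u.
Proof.
move=> ch u0t; have /andP[u0 ut] := u0t.
have [utE|neut] := eqVneq u t.
  rewrite (_ : (fun n => _) = (fun _ : nat => h u)); first exact: cvg_cst.
  apply/funext => n; have [v [/andP[uv vt] _] ->] := step_sumE h n u0t.
  by congr h; apply/eqP; rewrite eq_le uv andbT utE.
have {}ut : (u < t)%R by rewrite lt_neqAle neut.
have /cvgrPdist_le hc : {for u, continuous h} by apply: ch; rewrite in_itv/= u0 ut.
apply/cvgrPdist_le => e e0; have [d /= d0 hd] := hc e e0.
have : (t / n.+1%:R)%R @[n --> \oo] --> (t * 0 : R)%R.
  by apply: cvgMr; exact: cvg_harmonic.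
rewrite mulr0 => /cvgr0_norm_lt /(_ _ d0) H; near=> n.
have [v [/andP[uv vt] vu] ->] := step_sumE h n u0t.
apply: hd; rewrite /= distrC ger0_norm ?subr_ge0//.
rewrite ltrBlDl (le_lt_trans vu)// ltrD2l (le_lt_trans (ler_norm _))//.
by near: n; exact: H.
Unshelve. all: by end_near. Qed.

(** Dominated convergence with the constant [M]. Measurability of [h] on []0, t]] is obtained as
    that of a pointwise limit of step functions. *)
Lemma cvg_riemann_stieltjes h M : m `]0%R, t]%classic < +oo ->
  (forall u, (0 <= h u <= M)%R) -> {in `]0%R, t[, continuous h} ->
  m.-integrable `]0%R, t] (fun u => (h u)%:E) /\
  \sum_(i < n.+1) (h (grid n i.+1))%:E * m `]grid n i, grid n i.+1]%classic
    @[n --> \oo] --> \int[m]_(u in `]0%R, t]) (h u)%:E.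
Proof.
move=> mt hM ch.
have mD : measurable (`]0%R, t]%classic : set (measurableTypeR R)) by exact: measurable_itv.
have mstep n : measurable_fun (`]0%R, t]%classic : set (measurableTypeR R)) (fun u => (step_sum h n u)%:E).
  apply/measurable_EFinP; apply: measurable_sum => i; apply: measurable_funM => //.
have cvgh u : `]0%R, t]%classic u -> (step_sum h n u)%:E @[n --> \oo] --> (h u)%:E.
  rewrite /= in_itv/= => u0t; apply: cvg_EFin; first exact: nearW.
  exact: cvg_step_sum.
have mh : measurable_fun (`]0%R, t]%classic : set (measurableTypeR R)) (fun u => (h u)%:E).
  exact: (emeasurable_fun_cvg (fun n u => (step_sum h n u)%:E)).
have iM : m.-integrable `]0%R, t] (cst M%:E).
  apply/integrableP; split => //=; rewrite integral_cst//= lte_mul_pinfty//.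
have hle n u : `]0%R, t]%classic u -> `|(step_sum h n u)%:E| <= M%:E.
  rewrite /= in_itv/= => u0t; have [v _ ->] := step_sumE h n u0t.
  by have /andP[h0 h1] := hM v; rewrite lee_fin ger0_norm.
have [||//|||ih _ H] := @dominated_convergence _ _ _ m _ mD
    (fun n u => (step_sum h n u)%:E) (fun u => (h u)%:E) (cst M%:E) => //.
- by apply: aeW => u; exact: cvgh.
- by apply: aeW => u n; exact: hle.
split=> //.
rewrite (_ : (fun n => _) = (fun n => \int[m]_(u in `]0%R, t]) (step_sum h n u)%:E))//.
apply/funext => n; apply/esym.
under eq_integral do rewrite /step_sum -sumEFin.
rewrite ge0_integral_sum//; last 2 first.
- by move=> i; apply/measurable_EFinP/measurable_funM.
- by move=> i u _; rewrite lee_fin mulr_ge0//; have /andP[] := hM (grid n i.+1).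
apply: eq_bigr => i _.
under eq_integral do rewrite EFinM.
rewrite ge0_integralZl//; last 2 first.
- exact/measurable_EFinP.
- by have /andP[] := hM (grid n i.+1); rewrite lee_fin.
rewrite integral_indic//; congr (_ * m _); apply/setIidPl => u /=.
rewrite !in_itv/= => /andP[gu ug]; apply/andP; split.
  by rewrite (le_lt_trans _ gu)// -(grid0 n) le_grid.
by rewrite (le_trans ug)// -[leRHS](gridn n) le_grid.
Qed.

End riemann_stieltjes.

(** * The Cauchy law as the image of a uniform law under the cotangent *)

Section cot_cauchy.
Context {R : realType}.
Local Notation mu := (@lebesgue_measure R).
Variables (d : measure_display) (T : measurableType d) (P : probability T R).
Variables (C : {RV P >-> R}) (C_cauchy : has_density C cauchy_pdf).
Variables (t : R) (t0 : 0 < t).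

Let cott (u : R) : R := cot (pi * u / t).

Lemma measurable_cot : measurable_fun setT (@cot R).
Proof.
apply: measurable_funM.
  by apply: continuous_measurable_fun; exact: continuous_cos.
apply: (measurableT_comp measurable_inv).
by apply: continuous_measurable_fun; exact: continuous_sin.
Qed.

Let mcott : measurable_fun setT cott.
Proof.
apply: measurableT_comp; first exact: measurable_cot.
by apply: measurable_funM => //; exact: measurable_funM.
Qed.

Lemma cot_gt (x a : R) : 0 < x -> x < pi -> (a < cot x) = (x < pi / 2 - atan a).
Proof.
move=> x0 xpi; have p0 := pi_gt0 R.
have -> : cot x = tan (pi / 2 - x).
  rewrite /cot /tan -(cosN (pi / 2 - x)) opprB cosBpihalf.
  by rewrite -[pi / 2 - x]opprB sinN sinBpihalf opprK.
rewrite -{1}(atanK a) ltr_tan ?in_itv/= ?atan_gtNpi2 ?atan_ltpi2//; last first.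
  by apply/andP; split; lra.
by rewrite ltrBrDr ltrBrDr addrC.
Qed.

Lemma cauchy_ray a :
  (\int[mu]_(x in `]a, +oo[) (cauchy_pdf x)%:E = ((pi / 2 - atan a) / pi)%:E)%E.
Proof.
have p0 := pi_gt0 R.
have c0 (x : R) : 0 < 1 + x ^+ 2 by rewrite ltr_pwDl ?sqr_ge0.
have mc (D : set R) : measurable_fun D (fun x : R => (cauchy_pdf x)%:E).
  apply/measurable_EFinP/measurable_funTS.
  apply: (measurableT_comp measurable_inv); apply: measurable_funM => //.
  by apply: measurable_funD => //; exact: measurable_funX.
have dF x : a <= x -> is_derive x 1 (fun x => atan x / pi) (cauchy_pdf x).
  move=> _; apply: trigger_derive; rewrite /GRing.scale/= /cauchy_pdf.
  have := c0 x; move: (@pi R) p0 => p p0 cx; field.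
  by rewrite !gt_eqF.
rewrite integral_itv_obnd_cbnd//.
rewrite (ge0_FTC_ray (l := pi / 2 / pi) _ _ dF).
- by congr EFin; rewrite -mulrBl.
- by move=> x _; rewrite invr_ge0 mulr_ge0 ?ltW.
- move=> x _; apply: cvgV; first by rewrite mulf_neq0 ?gt_eqF.
  apply: cvgM; first exact: cvg_cst.
  by apply: cvgD; [exact: cvg_cst|exact: exprn_continuous].
- by apply: cvgMl; exact: cvgy_atan.
Qed.

(** The two measures are compared on rays: for [u] in []0, t[], [a < cot (pi u / t)] means
    [u < t (pi / 2 - atan a) / pi], and this length is [t] times the Cauchy tail at [a]. *)
Lemma integral_cot_cauchy (h : R -> R) : measurable_fun setT h -> (forall c, 0 <= h c) ->
  (\int[mu]_(u in `]0%R, t]) (h (cott u))%:E = t%:E * \int[P]_w (h (C w))%:E)%E.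
Proof.
move=> mh h0; have p0 := pi_gt0 R.
have tn : (0 <= t)%R by exact: ltW.
pose tn' := NngNum tn.
have mC : measurable_fun setT (C : T -> measurableTypeR R) by exact: (measurable_funPT C).
pose Y : {mfun T >-> measurableTypeR R} :=
  HB.pack (C : T -> measurableTypeR R) (isMeasurableFun.Build _ _ _ _ _ mC).
pose W : R -> R := \1_(`]0, t[).
have W0 u : 0 <= W u by [].
have mW : measurable_fun setT W by exact: measurable_indic.
have mho : measurable_fun setT (fun u => h (cott u)) by exact: measurableT_comp.
transitivity (\int[mu]_u ((W u)%:E * (h (cott u))%:E))%E.
  (* The endpoint [t], where [cot] takes its junk value, is a null set. *)
  rewrite -(@integral_itv_bndo_bndc _ (BRight 0)); last first.
    by apply/measurable_EFinP; exact: measurable_funTS.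
  rewrite integral_mkcond; apply: eq_integral => u _; rewrite patchE /W indicE.
  by case: ifP; rewrite ?mul1e ?mul0e.
have mC2 : measurable_fun setT (cott : measurableTypeR R -> measurableTypeR R) by exact: mcott.
pose Z : {mfun measurableTypeR R >-> measurableTypeR R} :=
  HB.pack (cott : measurableTypeR R -> measurableTypeR R) (isMeasurableFun.Build _ _ _ _ _ mC2).
pose m1' : {measure set (measurableTypeR R) -> \bar R} :=
  pushforward (density_measure mu W0 mW) Z.
pose m1 := m1' mC2.
pose m2 : {measure set (measurableTypeR R) -> \bar R} := mscale tn' (distribution P Y).
have m12 a : m1 `]a, +oo[%classic = m2 `]a, +oo[%classic.
  have -> : m2 `]a, +oo[%classic = (t%:E * ((pi / 2 - atan a) / pi)%:E)%E.
    by rewrite -cauchy_ray -(C_cauchy (measurable_itv _)).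
  transitivity (\int[mu]_(u in cott @^-1` `]a, +oo[) (W u)%:E)%E; first by [].
  have a1 := @atan_gtNpi2 R a; have a2 := @atan_ltpi2 R a.
  rewrite integral_mkcond.
  rewrite (_ : _ \_ _ = (fun u => (\1_(`]0, (t * ((pi / 2 - atan a) / pi))[) u)%:E)).
    transitivity (mu `]0%R, (t * ((pi / 2 - atan a) / pi))%R[%classic).
      by rewrite integral_indic// setIT.
    rewrite lebesgue_measure_itv/= lte_fin.
    rewrite mulr_gt0 ?divr_gt0 ?subr_gt0//.
    by rewrite -EFinB subr0 EFinM.
  apply/funext => u; rewrite patchE /W !indicE.
  have inO b : (u \in (`]0, b[%classic : set R)) = (0 < u < b) by rewrite mem_setE in_itv.
  rewrite !{}inO; have [u0|u0]/= := ltP 0 u; last by case: ifP.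
  have [ut|tu] := ltP u t; last first.
    rewrite ltNge (le_trans _ tu); first by case: ifP.
    by rewrite -[leRHS]mulr1 ler_pM2l// ler_pdivrMr// mul1r; lra.
  have x0 : 0 < pi * u / t by rewrite divr_gt0// mulr_gt0.
  have xpi : pi * u / t < pi by rewrite ltr_pdivrMr// ltr_pM2l.
  have -> : (u < t * ((pi / 2 - atan a) / pi)) = (a < cott u).
    by rewrite /cott cot_gt// ltr_pdivrMr// mulrA ltr_pdivlMr// [u * pi]mulrC [t * _]mulrC.
  by rewrite (_ : (u \in _) = (a < cott u)) ?in_setE; [case: ifP|apply/idP/idP; rewrite inE/= in_itv/= andbT].
have mm A : measurable A -> m1 A = m2 A.
  move=> mA; apply: (@measure_unique _ R (measurableTypeR R) [set A | exists x, A = `]x, +oo[%classic]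
    (fun k => `]- k%:R, +oo[%classic)) => //.
  - exact: RGenOInfty.measurableE.
  - move=> _ _ [x ->] [y ->]; exists (Num.max x y).
    by apply/seteqP; split => z/=; rewrite !in_itv/= !andbT gt_max => /andP.
  - by move=> i; exists (- i%:R).
  - apply/seteqP; split=> // x _; exists (Num.truncn `|x|).+1 => //=.
    rewrite in_itv/= andbT ltrNl (le_lt_trans _ (truncnS_gt _))//.
    by rewrite -normrN ler_norm.
  - by move=> _ [x ->].
  - move=> k; rewrite m12; apply: (@le_lt_trans _ _ (t%:E * 1)%E).
      rewrite /m2 /mscale/= lee_wpmul2l ?lee_fin//.
      exact: (probability_le1 (distribution P Y) (measurable_itv _)).
    by rewrite mule1 ltry.
transitivity (\int[m1]_x (h x)%:E)%E.
  rewrite ge0_integral_pushforward//.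
  - rewrite preimage_setT ge0_integral_density_measure//.
    + exact/measurable_EFinP.
    + by move=> x; rewrite lee_fin h0.
  - exact/measurable_EFinP.
  - by move=> x _; rewrite lee_fin h0.
rewrite (eq_measure_integral m2); last by move=> A mA _; exact: mm.
rewrite ge0_integral_mscale//.
- by rewrite ge0_integral_distribution//; exact/measurable_EFinP.
- exact/measurable_EFinP.
- by move=> x _; rewrite lee_fin h0.
Qed.

End cot_cauchy.

(** * The laws of Gamma_1 and D_1 *)

Section independent_pair.
Local Open Scope ereal_scope.
Context {R : realType} d (T : measurableType d) (P : probability T R).

(** Independence fixes the joint law on measurable rectangles, which makes it the product of the two
    laws. *)
Lemma independent_ge0_integral (X Y : {RV P >-> R}) (h : R * R -> \bar R) :
  independent P X Y -> measurable_fun setT h -> (forall z, 0 <= h z) ->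
  \int[P]_w h (X w, Y w) = \int[P]_w \int[P]_w' h (X w', Y w).
Proof.
move=> XY mh h0.
have mZ : measurable_fun setT (fun w => (X w, Y w)) by exact: measurable_fun_pair.
pose Z : {mfun T >-> (R * R)%type} := HB.pack (fun w => (X w, Y w)) (isMeasurableFun.Build _ _ _ _ _ mZ).
transitivity (\int[distribution P Z]_z h z).
  by rewrite ge0_integral_distribution.
rewrite (eq_measure_integral (distribution P X \x distribution P Y)); last first.
  by move=> A mA _; apply/esym/product_measure_unique => //= A' B' mA' mB'; exact: XY.
rewrite fubini_tonelli2// ge0_integral_distribution//=.
- by apply: eq_integral => w _; rewrite /fubini_G ge0_integral_distribution//; exact: measurableT_comp.
- exact: measurable_fun_fubini_tonelli_G.
- by move=> y; apply: integral_ge0.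
Qed.

Lemma measurable_integral_pair (X Y : {RV P >-> R}) (h : R * R -> \bar R) :
  measurable_fun setT h -> (forall z, 0 <= h z) ->
  measurable_fun setT (fun w => \int[P]_w' h (X w', Y w)).
Proof.
move=> mh h0.
have mf : measurable_fun setT (fun z : T * R => h (X z.1, z.2)).
  apply: (measurableT_comp mh); apply: measurable_fun_pair => //.
  exact: measurableT_comp.
have H := @measurable_fun_fubini_tonelli_G _ _ _ _ _ P _ mf (fun z => h0 _).
exact: (measurableT_comp H (measurable_funPT Y)).
Qed.

End independent_pair.

(** * The two densities and their transforms *)

Section gamma_density.
Context {R : realType}.
Local Notation leb := (@lebesgue_measure R).
Variables (m : R) (m0 : 0 < m).

Definition Gamma1_pdf (x : R) : R :=
  1 / ln (1 + 1 / m) * expR (- m * x) * ((1 - expR (- x)) / x) * \1_(`[0, +oo[) x.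

Definition D1_pdf (x : R) : R :=
  1 / ln (1 + 1 / m) * (1 / x) * \1_(`[1 / (m + 1), 1 / m]) x.

Lemma ln_1Dinv_gt0 (x : R) : 0 < x -> 0 < ln (1 + 1 / x).
Proof. by move=> x0; rewrite ln_gt0// ltrDl divr_gt0. Qed.

Let L0 : 0 < ln (1 + 1 / m). Proof. exact: ln_1Dinv_gt0. Qed.

Lemma Gamma1_pdf_le0 x : x <= 0 -> Gamma1_pdf x = 0.
Proof.
(* At 0, which belongs to [[0, +oo[], the value is 0 by the convention [0^-1 = 0]. *)
rewrite le_eqVlt => /predU1P[->|x0]; first by rewrite /Gamma1_pdf invr0 !mulr0 mul0r.
by rewrite /Gamma1_pdf indicE memNset ?mulr0//= in_itv/= andbT leNgt x0.
Qed.

Lemma Gamma1_pdf_gt0E x : 0 < x ->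
  Gamma1_pdf x = 1 / ln (1 + 1 / m) * ((1 - expR (- x)) / x * expR (- m * x)).
Proof.
move=> x0; rewrite /Gamma1_pdf indicE mem_set ?mulr1/=; last by rewrite in_itv/= (ltW x0).
by rewrite -mulrA [expR (- m * x) * _]mulrC.
Qed.

Lemma Gamma1_pdf_ge0 x : 0 <= Gamma1_pdf x.
Proof.
have [x0|x0] := leP x 0; first by rewrite Gamma1_pdf_le0.
rewrite Gamma1_pdf_gt0E// mulr_ge0 ?divr_ge0 ?(ltW L0)// mulr_ge0 ?expR_ge0//.
by rewrite divr_ge0 ?(ltW x0)// subr_ge0 -expR0 ler_expR oppr_le0 ltW.
Qed.

Lemma measurable_Gamma1_pdf : measurable_fun setT Gamma1_pdf.
Proof.
apply: measurable_funM => //; apply: measurable_funM; last first.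
  apply: measurable_funM; last exact: measurable_inv.
  by apply: measurable_funB => //; apply: measurableT_comp.
by apply: measurable_funM => //; exact: measurable_expRM.
Qed.

Lemma D1_pdf_out x : ~~ (1 / (m + 1) <= x <= 1 / m) -> D1_pdf x = 0.
Proof. by move=> H; rewrite /D1_pdf indicE memNset ?mulr0//= in_itv/=; exact/negP. Qed.

Lemma D1_pdf_le0 x : x <= 0 -> D1_pdf x = 0.
Proof.
move=> x0; apply: D1_pdf_out; rewrite (lt_geF (le_lt_trans x0 _))//.
by rewrite divr_gt0// addr_gt0.
Qed.

Lemma D1_pdf_ge0 x : 0 <= D1_pdf x.
Proof.
have [x0|x0] := leP x 0; first by rewrite D1_pdf_le0.
by rewrite !mulr_ge0 ?invr_ge0 ?(ltW L0) ?(ltW x0)// indicE.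
Qed.

Lemma measurable_D1_pdf : measurable_fun setT D1_pdf.
Proof.
apply: measurable_funM => //; apply: measurable_funM => //.
by apply: measurable_funM => //; exact: measurable_inv.
Qed.

(** Frullani's formula with parameters [l + m] and 1. At [l = 0] it gives the normalization of the
    density. *)
Lemma Gamma1_pdf_laplace l : 0 <= l ->
  (\int[leb]_x (Gamma1_pdf x * expR (- l * x))%:E =
   (ln (1 + 1 / (l + m)) / ln (1 + 1 / m))%:E)%E.
Proof.
move=> l0; have lm : 0 < l + m by rewrite ltr_wpDl.
transitivity (\int[leb]_(x in `]0%R, +oo[) ((1 / ln (1 + 1 / m))%:E *
    ((1 - expR (- 1 * x)) / x * expR (- (l + m) * x))%:E))%E.
  rewrite [RHS]integral_mkcond; apply: eq_integral => x _; rewrite patchE.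
  have [x0|x0] := leP x 0.
    rewrite Gamma1_pdf_le0// mul0r memNset//= in_itv/= andbT.
    by apply/negP; rewrite -leNgt.
  rewrite mem_set/=; last by rewrite in_itv/= x0.
  rewrite -EFinM Gamma1_pdf_gt0E//; congr EFin.
  by rewrite -(mulrA _ _ (expR _)) -(mulrA _ (expR _)) -expRD mulN1r; congr (_ * (_ * expR _)); ring.
rewrite ge0_integralZl//.
- by rewrite frullani// -EFinM; congr EFin; rewrite div1r mulrC.
- apply/measurable_EFinP; apply: measurable_funM; last exact: measurable_expRM.
  apply: measurable_funM; last by apply: measurable_funTS; exact: measurable_inv.
  by apply: measurable_funB => //; exact: measurable_expRM.
- move=> x; rewrite /= in_itv/= andbT => x0; rewrite lee_fin mulr_ge0 ?expR_ge0//.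
  by rewrite divr_ge0 ?(ltW x0)// subr_ge0 mulN1r -expR0 ler_expR oppr_le0 ltW.
- by rewrite lee_fin divr_ge0// ltW.
Qed.

(** [e^(- y / x) / y] is a primitive in [x]. In the variable [v = 1 / x] this is the integral of
    [e^(- v y)] over [v] between [m] and [m + 1]. *)
Lemma integral_inv_segment_expR y : 0 < y ->
  (\int[leb]_(x in `[(1 / (m + 1))%R, (1 / m)%R]) (expR (- x^-1 * y) / x ^+ 2)%:E =
   ((1 - expR (- y)) / y * expR (- m * y))%:E)%E.
Proof.
move=> y0; have m1 : 0 < m + 1 by rewrite addr_gt0.
have pos x : 1 / (m + 1) <= x <= 1 / m -> 0 < x.
  by move=> /andP[+ _]; apply: lt_le_trans; rewrite divr_gt0.
have ab : 1 / (m + 1) < 1 / m by rewrite !div1r ltf_pV2 ?posrE// ltrDl.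
have dF (x : R) : 1 / (m + 1) <= x <= 1 / m ->
    is_derive x 1 (fun x => expR (- x^-1 * y) / y) (expR (- x^-1 * y) / x ^+ 2).
  move=> /pos x0; have xn : x != 0 by rewrite gt_eqF.
  have dV : is_derive x 1 (fun x : R => x^-1) (- x ^- 2 *: 1) by exact: (is_deriveV (f := id)).
  apply: trigger_derive; rewrite /GRing.scale/=; field.
  by rewrite xn gt_eqF.
rewrite (FTC_segment ab _ dF).
  rewrite !div1r !invrK opprD mulrDl mulN1r expRD; congr EFin; field.
  by rewrite gt_eqF.
move=> x /pos x0; apply: cvgM.
  apply: continuous_cvg; first exact: continuous_expR.
  by apply: cvgM; [apply: cvgN; apply: cvgV; rewrite ?gt_eqF//; exact: cvg_id|exact: cvg_cst].
by apply: cvgV; [rewrite expf_neq0// gt_eqF|exact: exprn_continuous].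
Qed.

(** [e^(- a / x) / x] is the integral of [e^(- y / x) / x^2] over [y > a]; after the exchange, the
    integral over [x] yields the density of [Gamma_1] at [y]. *)
Lemma D1_pdf_laplace a : 0 <= a ->
  (\int[leb]_x (D1_pdf x * expR (- a * x^-1))%:E =
   \int[leb]_(y in `]a, +oo[) (Gamma1_pdf y)%:E)%E.
Proof.
move=> a0; have m1 : 0 < m + 1 by rewrite addr_gt0.
have pos x : 1 / (m + 1) <= x <= 1 / m -> 0 < x.
  by move=> /andP[+ _]; apply: lt_le_trans; rewrite divr_gt0.
pose c := 1 / ln (1 + 1 / m).
have c0 : 0 <= c by rewrite divr_ge0// ltW.
transitivity (\int[leb]_(x in `[(1 / (m + 1))%R, (1 / m)%R]) \int[leb]_(y in `]a, +oo[)
   (c * (expR (- x^-1 * y) / x ^+ 2))%:E)%E.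
  rewrite [RHS]integral_mkcond; apply: eq_integral => x _; rewrite patchE.
  case: ifPn => [|xD]; last first.
    rewrite D1_pdf_out ?mul0r//; apply: contra xD => xD.
    by rewrite inE/= in_itv.
  rewrite inE/= in_itv/= => xD; have x0 := pos x xD.
  have xi : 0 < x^-1 by rewrite invr_gt0.
  under eq_integral do rewrite mulrCA mulrC EFinM.
  rewrite ge0_integralZl//; last 2 first.
  - by apply/measurable_EFinP; exact: measurable_expRM.
  - by rewrite lee_fin mulr_ge0// invr_ge0 exprn_ge0// ltW.
  rewrite integral_itv_obnd_cbnd; last exact: measurable_EFin_expRM.
  rewrite integral_expRM_ray// -EFinM; congr EFin.
  rewrite /D1_pdf indicE mem_set/= ?in_itv//= mulr1 -/c [- a * _]mulrC mulrN mulNr.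
  by field; rewrite gt_eqF.
rewrite ge0_tonelli_on//; last 2 first.
- apply: measurable_funM => //; apply: measurable_funM.
    apply: measurableT_comp => //; apply: measurable_funM => //.
    by apply: measurableT_comp => //; apply: (measurableT_comp measurable_inv).
  by apply: (measurableT_comp measurable_inv); apply: measurable_funX.
- by move=> x y _ _; rewrite mulr_ge0// mulr_ge0 ?expR_ge0// invr_ge0 sqr_ge0.
apply: eq_integral => y; rewrite inE/= in_itv/= andbT => ay.
have y0 : 0 < y by exact: le_lt_trans ay.
rewrite Gamma1_pdf_gt0E// -/c EFinM -integral_inv_segment_expR//.
rewrite -ge0_integralZl//.
- apply/measurable_EFinP/measurable_funTS/measurable_funM.
    by apply: measurableT_comp => //; apply: measurable_funM => //; apply: measurableT_comp => //; exact: measurable_inv.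
  by apply: (measurableT_comp measurable_inv); exact: measurable_funX.
- by move=> x _; rewrite lee_fin mulr_ge0 ?expR_ge0// invr_ge0 sqr_ge0.
Qed.

End gamma_density.

Section probability_preimage.
Local Open Scope ereal_scope.
Context {R : realType} d (T : measurableType d) (P : probability T R).

Lemma probability_preimageE (f : T -> R) (B : set R) :
  measurable_fun setT f -> measurable B ->
  P (f @^-1` B) = \int[P]_w (\1_B (f w) : R)%:E.
Proof.
move=> mf mB; have mfB : measurable (f @^-1` B).
  by rewrite -[X in measurable X]setTI; exact: mf.
transitivity (\int[P]_w (\1_(f @^-1` B) w : R)%:E).
  by rewrite integral_indic// setIT.
by apply: eq_integral => w _; rewrite !indicE.
Qed.

End probability_preimage.

(** * The law of D_1, recovered from its product with an exponential variable *)

Section D1_law.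
Context {R : realType}.
Local Notation leb := (@lebesgue_measure R).
Variables (m : R) (m0 : 0 < m).
Variables (d : measure_display) (T : measurableType d) (P : probability T R).
Variables (D1 gamma1 : {RV P >-> R}).
Hypothesis gamma1_exp : has_density gamma1 (exponential_pdf 1).
Hypothesis gamma1D1 : independent P gamma1 D1.
Hypothesis gamma1D1_law : forall A : set R, measurable A ->
  P ((fun w => gamma1 w * D1 w) @^-1` A) = (\int[leb]_(x in A) (Gamma1_pdf m x)%:E)%E.

Let mG : measurable_fun setT gamma1. Proof. exact: measurable_funPT. Qed.
Let mD1 : measurable_fun setT D1. Proof. exact: measurable_funPT. Qed.

(** No sign is assumed for [D1]. Where [D1 <= 0], either [gamma1 < 0] or [gamma1 * D1 <= 0], and the
    known densities make both events null. *)
Lemma negligible_D1_le0 : P.-negligible (D1 @^-1` `]-oo, 0]%classic).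
Proof.
have N1 : P.-negligible (gamma1 @^-1` `]-oo, 0[%classic).
  apply/negligibleP; first by rewrite -[X in measurable X]setTI; exact: mG.
  rewrite [LHS](gamma1_exp (measurable_itv _)); apply: integral0_eq => x /=.
  by rewrite in_itv/= => x0; rewrite lt0_exponential_pdf.
have N2 : P.-negligible ((fun w => gamma1 w * D1 w) @^-1` `]-oo, 0]%classic).
  apply/negligibleP.
    by rewrite -[X in measurable X]setTI; apply: measurable_funM.
  rewrite [LHS](gamma1D1_law (measurable_itv _)); apply: integral0_eq => x /=.
  by rewrite in_itv/= => x0; rewrite Gamma1_pdf_le0.
apply: negligibleS (negligibleU N1 N2) => w /=; rewrite !in_itv/= => D0.
have [g0|g0] := ltP (gamma1 w) 0; [by left|right].
exact: mulr_ge0_le0.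
Qed.

Lemma exponential_tail a : 0 <= a -> P (gamma1 @^-1` `]a, +oo[%classic) = (expR (- a))%:E.
Proof.
move=> a0; rewrite [LHS](gamma1_exp (measurable_itv _)).
transitivity (\int[leb]_(x in `]a, +oo[) (expR (- 1 * x))%:E)%E.
  apply: eq_integral => x; rewrite inE/= in_itv/= andbT => ax.
  by rewrite /exponential_pdf patchE mem_set ?mul1r//= in_itv/= andbT (le_trans a0 (ltW ax)).
rewrite integral_itv_obnd_cbnd; last exact: measurable_EFin_expRM.
by rewrite integral_expRM_ray// mulN1r divr1.
Qed.

(** A version of [1 / D1] that is nonnegative everywhere, as the identification by Laplace
    transforms requires; it differs from [1 / D1] on a null event only. *)
Let Z w := (Num.max 0 (D1 w))^-1.

(* Conditioning on [D1] gives [P (gamma1 * D1 > a) = E e^(- a / D1)], so that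
   the tail of [Gamma_1] is the Laplace transform of the law of [1 / D1]. *)
Lemma D1_inv_laplace n : (\int[P]_w (expR (- n%:R * Z w))%:E =
  \int[leb]_x (D1_pdf m x * expR (- n%:R * x^-1))%:E)%E.
Proof.
have n0 : (0 : R) <= n%:R by [].
rewrite D1_pdf_laplace// -(gamma1D1_law (measurable_itv _)).
have mS : measurable (`]n%:R, +oo[%classic : set R) by exact: measurable_itv.
have mh : measurable_fun setT (fun z : R * R => (\1_(`]n%:R, +oo[) (z.1 * z.2) : R)%:E).
  apply/measurable_EFinP; apply: (measurableT_comp (f := \1_(`]n%:R, +oo[) : R -> R)) => //.
  exact: measurable_funM.
have mGD : measurable_fun setT (fun w => gamma1 w * D1 w) by exact: measurable_funM.
rewrite (probability_preimageE P mGD mS).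
rewrite (independent_ge0_integral gamma1D1 mh); last by move=> z; rewrite lee_fin.
apply: ge0_ae_eq_integral => //.
- apply/measurable_EFinP; apply: measurableT_comp => //; apply: measurable_funM => //.
  apply: (measurableT_comp measurable_inv); exact: measurable_maxr.
- exact: (measurable_integral_pair _ _ mh).
- by move=> w _; apply: integral_ge0 => w' _; rewrite lee_fin.
apply: negligibleS negligible_D1_le0 => w /=; apply: contra_notT.
rewrite in_itv/= -ltNge => Dw _; rewrite /Z (max_idPr (ltW Dw)).
rewrite -(probability_preimageE P (f := fun w' => gamma1 w' * D1 w)) //; last exact: measurable_funM.
rewrite mulNr -exponential_tail; last by rewrite divr_ge0// ltW.
congr (P _); apply/seteqP; split => w' /=; rewrite !in_itv/= !andbT.
  by rewrite ltr_pdivrMr.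
by rewrite ltr_pdivrMr.
Qed.

(** The law of [Z] is the image [nu] of the candidate density under inversion. Inversion is an
    involution of the whole line, 0 included by the convention [0^-1 = 0], so the law of [D1] at [A]
    is that of [Z] at the preimage of [A]. *)
Lemma D1_has_density : has_density D1 (D1_pdf m).
Proof.
move=> A mA.
have mI : measurable_fun setT (@GRing.inv R : measurableTypeR R -> measurableTypeR R) by exact: measurable_inv.
pose V : {mfun measurableTypeR R >-> measurableTypeR R} :=
  HB.pack (@GRing.inv R : measurableTypeR R -> measurableTypeR R) (isMeasurableFun.Build _ _ _ _ _ mI).
pose nu' : {measure set (measurableTypeR R) -> \bar R} :=
  pushforward (density_measure leb (D1_pdf_ge0 m0) (measurable_D1_pdf m)) V.
pose nu := nu' mI.
have nuE (B : set R) : nu B = (\int[leb]_(x in V @^-1` B) (D1_pdf m x)%:E)%E by [].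
have mZ : measurable_fun setT Z.
  apply: (measurableT_comp measurable_inv); exact: measurable_maxr.
have Z0 w : 0 <= Z w by rewrite invr_ge0 le_max lexx.
have mVA : measurable (V @^-1` A) by rewrite -[X in measurable X]setTI; apply: (mI measurableT).
have H := @measure_laplace_law _ _ _ P Z nu mZ Z0 _ _ _ _ mVA.
transitivity (P (Z @^-1` (V @^-1` A))).
  rewrite [LHS](probability_preimageE P mD1 mA).
  rewrite [RHS](probability_preimageE P mZ mVA).
  apply: ge0_ae_eq_integral => //.
  - by apply/measurable_EFinP; exact: measurableT_comp.
  - by apply/measurable_EFinP; apply: (measurableT_comp (f := \1_(V @^-1` A) : R -> R)).
  apply: negligibleS (negligible_D1_le0) => w /=; apply: contra_notT.
  rewrite in_itv/= -ltNge => Dw _; rewrite !indicE; congr (_%:R%:E).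
  suff E : Z w = (D1 w)^-1.
    by congr (nat_of_bool _); apply/idP/idP; rewrite !inE /preimage/= E invrK.
  by rewrite /Z (max_idPr (ltW Dw)).
rewrite H.
- rewrite nuE; congr (integral _ _ _).
  by apply/seteqP; split => x /=; rewrite invrK.
- rewrite nuE preimage_setT.
  have := D1_inv_laplace 0.
  under eq_integral do rewrite oppr0 mul0r expR0.
  rewrite [LHS](_ : _ = 1%E); last by rewrite integral_cst//= mul1e probability_setT.
  under eq_integral do rewrite oppr0 mul0r expR0 mulr1.
  by move=> <-; exact: ltry.
- rewrite nuE; apply: integral0_eq => x; rewrite /= in_itv/= => x0.
  by rewrite D1_pdf_le0// -invr_le0 ltW.
move=> n; rewrite D1_inv_laplace [RHS]integral_mkcond.
have mD : measurable (`[0%R, +oo[%classic : set (measurableTypeR R)) by exact: measurable_itv.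
have mE : measurable_fun setT ((fun x => (expR (- n%:R * x))%:E) \_ (`[0%R, +oo[%classic : set (measurableTypeR R))).
  by apply/(measurable_restrictT _ mD); exact: measurable_EFin_expRM.
have E0 x : (0 <= ((fun x => (expR (- n%:R * x))%:E) \_ (`[0%R, +oo[%classic : set (measurableTypeR R))) x)%E.
  by rewrite patchE; case: ifP => // _; rewrite lee_fin expR_ge0.
rewrite ge0_integral_pushforward// preimage_setT ge0_integral_density_measure//; last 2 first.
- exact: (measurableT_comp mE).
- by move=> x; exact: E0.
apply: eq_integral => x _ /=; rewrite patchE.
have [x0|x0] := leP x 0; first by rewrite D1_pdf_le0// mul0r mul0e.
by rewrite mem_set ?EFinM//= in_itv/= andbT invr_ge0 ltW.
Qed.

End D1_law.

(** * The Wiener-Gamma representation *)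

Section wiener_gamma.
Context {R : realType} (d : measure_display) (T : measurableType d).
Variables (P : probability T R) (gam : subordinator P).
Hypothesis gam_std : standard_gamma_process gam.
Local Notation leb := (@lebesgue_measure R).

Lemma gamma_process_laplace l r : 0 <= l -> 0 <= r ->
  (\int[P]_w (expR (- l * gam r w))%:E = (expR (- (r * ln (1 + l))))%:E)%E.
Proof.
move=> l0 r0; have := gam_std l0 r0; rewrite unlock => ->.
transitivity (expeR (- (r%:E * (ln (1 + l / 1))%:E)))%E; last by rewrite divr1.
rewrite -frullani//; congr (expeR (- (_ * _)))%E.
apply: eq_integral => x _; rewrite -EFinM; congr EFin.
by rewrite mulN1r mulrA.
Qed.

(* Unqualified, [sub_path] is a lemma of [path]. *)
Definition path_measure (w : T) : {measure set (measurableTypeR R) -> \bar R} :=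
  lebesgue_stieltjes_measure (Defs.sub_path gam w).

Lemma path_measure_itv a b w : 0 <= a -> a <= b ->
  path_measure w `]a, b]%classic = (gam b w - gam a w)%:E.
Proof.
move=> a0 ab; transitivity (lebesgue_stieltjes_measure (Defs.sub_path gam w) `]a, b]%classic) => //.
rewrite /lebesgue_stieltjes_measure /measure_extension/=.
rewrite measurable_mu_extE/= ?wlength_itv_bnd//; last exact: is_ocitv.
by rewrite /Defs.sub_path (max_idPr a0) (max_idPr (le_trans a0 ab)) EFinB.
Qed.

Variables (t : R) (t0 : 0 < t) (h : R -> R) (M : R).
Hypothesis hM : forall u, 0 <= h u <= M.
Hypothesis ch : {in `]0, t[, continuous h}.

Local Notation inc n i w := (gam (grid t n i.+1) w - gam (grid t n i) w).

Let S n w := \sum_(i < n.+1) h (grid t n i.+1) * inc n i w.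

Lemma grid_ge0 n i : 0 <= grid t n i.
Proof. by rewrite mulr_ge0// ltW. Qed.

Lemma inc_ge0 n i w : 0 <= inc n i w.
Proof. by rewrite subr_ge0 sub_nondecreasing ?grid_ge0// le_grid. Qed.

Let minc n i : measurable_fun setT (fun w => inc n i w).
Proof. exact: measurable_funB. Qed.

Let mS n : measurable_fun setT (S n).
Proof. by apply: measurable_sum => i; apply: measurable_funM => //; exact: minc. Qed.

Let h0 u : 0 <= h u. Proof. by have /andP[] := hM u. Qed.

Let S0 n w : 0 <= S n w.
Proof. by apply: sumr_ge0 => i _; rewrite mulr_ge0// inc_ge0. Qed.

Lemma cvg_stieltjes_integral w : (S n w)%:E @[n --> \oo] --> stieltjes_integral gam h t w.
Proof.
have mt : (path_measure w `]0%R, t]%classic < +oo)%E.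
  by rewrite path_measure_itv ?ltry// ltW.
have [_] := @cvg_riemann_stieltjes R (path_measure w) t t0 h M mt hM ch.
rewrite /stieltjes_integral; apply: cvg_trans; apply: near_eq_cvg; apply: nearW => n.
rewrite -sumEFin; apply: eq_bigr => i _.
by rewrite path_measure_itv ?grid_ge0 ?le_grid// EFinM.
Qed.

Lemma stieltjes_integral_fin w : stieltjes_integral gam h t w \is a fin_num.
Proof.
have mt : (path_measure w `]0%R, t]%classic < +oo)%E.
  by rewrite path_measure_itv ?ltry// ltW.
have [hi _] := @cvg_riemann_stieltjes R (path_measure w) t t0 h M mt hM ch.
by apply: integrable_fin_num => //; exact: measurable_itv.
Qed.

Lemma measurable_stieltjes_integral : measurable_fun setT (stieltjes_integral gam h t).
Proof.
apply: (@emeasurable_fun_cvg _ _ _ _ (fun n w => (S n w)%:E)).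
  by move=> n; apply/measurable_EFinP.
by move=> w _; exact: cvg_stieltjes_integral.
Qed.

(** Independence factorizes the expectation; by stationarity each increment has the gamma law of
    parameter [t / n.+1], with transform [(1 + l h)^(- t / n.+1)] at [l h]. *)
Lemma laplace_riemann_sum l n : 0 <= l ->
  (\int[P]_w (expR (- l * S n w))%:E =
   (expR (- (\sum_(i < n.+1) ln (1 + l * h (grid t n i.+1)) * (t / n.+1%:R))))%:E)%E.
Proof.
move=> l0.
(* [Num.max 0 x] keeps each factor in [0, 1] on the whole line; it leaves the increments, which are
   nonnegative, unchanged. *)
pose f (i : 'I_n.+1) x := expR (- (l * h (grid t n i.+1)) * Num.max 0 x).
have mf i : measurable_fun setT (f i).
  by apply: measurableT_comp => //; apply: measurable_funM => //; exact: measurable_maxr.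
have f01 i x : 0 <= f i x <= 1.
  rewrite expR_ge0/= -[leRHS]expR0 ler_expR mulNr oppr_le0 mulr_ge0 ?mulr_ge0//.
  by rewrite le_max lexx.
transitivity (\int[P]_w (\prod_(i < n.+1) f i (inc n i w))%:E)%E.
  apply: eq_integral => w _; congr EFin; rewrite -expR_sum; congr expR.
  rewrite mulr_sumr; apply: eq_bigr => i _.
  by rewrite (max_idPr (inc_ge0 n i w)) mulrA mulNr.
have ind : mutually_independent P (fun (i : 'I_n.+1) w => inc n i w).
  apply: (sub_independent_increments gam (t := grid t n)) => [|i _]; first exact: grid_ge0.
  exact: le_grid.
rewrite (mutually_independent_expectation ind)//.
rewrite -sumrN expR_sum -prodEFin; apply: eq_bigr => i _.
have tn0 : 0 <= t / n.+1%:R by rewrite divr_ge0// ltW.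
have law : same_law P (fun w => inc n i w) P (gam (t / n.+1%:R)).
  rewrite gridS; apply: sub_stationary_increments => //; exact: grid_ge0.
have mfE : measurable_fun setT (fun x => (f i x)%:E) by exact/measurable_EFinP.
rewrite (same_law_ge0_integral law mfE); last by move=> x; rewrite lee_fin expR_ge0.
have E := gamma_process_laplace (mulr_ge0 l0 (h0 (grid t n i.+1))) tn0.
apply: (eq_trans _ (eq_trans E _)); last by rewrite [_ * ln _]mulrC.
apply: eq_integral => w _.
congr (expR (_ * _))%:E; apply/max_idPr.
by rewrite -(sub_start gam w) sub_nondecreasing.
Qed.

(** Riemann sums converge on both sides: along each path to the Stieltjes integral, and for the
    Lebesgue measure to the integral of the logarithm. The expectation passes to the limit because
    the exponentials are at most 1. *)
Lemma wiener_gamma_laplace l : 0 <= l ->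
  (\int[P]_w (expR (- l * fine (stieltjes_integral gam h t w)))%:E =
   expeR (- \int[leb]_(u in `]0%R, t]) (ln (1 + l * h u))%:E))%E.
Proof.
move=> l0.
have M0 : 0 <= M by have /andP[h1 h2] := hM 0; exact: le_trans h2.
have lh0 u : 0 <= l * h u by rewrite mulr_ge0.
have lhM u : 0 <= ln (1 + l * h u) <= ln (1 + l * M).
  rewrite ln_ge0 ?lerDl//= ler_ln ?posrE ?ltr_wpDr ?mulr_ge0//.
  by rewrite lerD2l ler_wpM2l//; have /andP[] := hM u.
have clh : {in `]0, t[, continuous (fun u => ln (1 + l * h u))}.
  move=> u ut; apply: continuous_comp; last by apply: continuous_ln; rewrite ltr_wpDr.
  by apply: cvgD; [exact: cvg_cst|apply: cvgM; [exact: cvg_cst|exact: ch]].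
have lebt : (leb `]0%R, t]%classic < +oo)%E.
  by rewrite lebesgue_measure_itv/= lte_fin t0 -EFinB ltry.
have [li H1] := @cvg_riemann_stieltjes R leb t t0 _ _ lebt lhM clh.
have Lfin : (\int[leb]_(u in `]0%R, t]) (ln (1 + l * h u))%:E \is a fin_num)%E.
  by apply: integrable_fin_num => //; exact: measurable_itv.
have HS w : (expR (- l * S n w))%:E @[n --> \oo] --> (expR (- l * fine (stieltjes_integral gam h t w)))%:E.
  apply: cvg_EFin; first exact: nearW.
  apply: continuous_cvg; first exact: continuous_expR.
  have := @cvg_stieltjes_integral w; rewrite -{1}(fineK (stieltjes_integral_fin w)).
  by move=> /fine_cvg /= H; apply: cvgMr; exact: H.
have [|||||_ _ HP] := @dominated_convergence _ _ _ P _ measurableT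
    (fun n w => (expR (- l * S n w))%:E)
    (fun w => (expR (- l * fine (stieltjes_integral gam h t w)))%:E) (cst 1%E) => //.
- move=> n; apply/measurable_EFinP; apply: measurableT_comp => //.
  exact: measurable_funM.
- apply/measurable_EFinP; apply: measurableT_comp => //; apply: measurable_funM => //.
  by apply: measurableT_comp => //; exact: measurable_stieltjes_integral.
- by apply: aeW => w _; exact: HS.
- apply/integrableP; split => //=.
  by rewrite integral_cst//= probability_setT normr1 mule1 ltry.
- apply: aeW => w n _; rewrite lee_fin ger0_norm ?expR_ge0//.
  by rewrite -[leRHS]expR0 ler_expR mulNr oppr_le0 mulr_ge0.
have {}HP : (expR (- \sum_(i < n.+1) ln (1 + l * h (grid t n i.+1)) * (t / n.+1%:R)))%:E
    @[n --> \oo] --> (\int[P]_w (expR (- l * fine (stieltjes_integral gam h t w)))%:E)%E.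
  apply: cvg_trans HP; apply: near_eq_cvg; apply: nearW => n /=.
  exact: laplace_riemann_sum.
rewrite -(fineK Lfin); apply: (cvg_unique _ HP) => //.
apply: cvg_EFin; first exact: nearW.
apply: continuous_cvg; first exact: continuous_expR.
have HL : (\sum_(i < n.+1) ln (1 + l * h (grid t n i.+1)) * (t / n.+1%:R))%:E
    @[n --> \oo] --> (fine (\int[leb]_(u in `]0%R, t]) (ln (1 + l * h u))%:E)%E)%:E.
  rewrite fineK//; apply: cvg_trans H1; apply: near_eq_cvg; apply: nearW => n /=.
  rewrite -sumEFin; apply: eq_bigr => i _; rewrite EFinM; congr (_ * _)%E.
  rewrite lebesgue_measure_itv/= lte_fin gridS ltrDl divr_gt0//.
  by rewrite -EFinB addrAC subrr add0r.
by move/fine_cvg: HL => /= HL; apply: cvgN; exact: HL.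
Qed.

End wiener_gamma.

Section wiener_gamma_kernel.
Context {R : realType}.
Variables (m : R) (m0 : 0 < m).

Definition wiener_kernel (c : R) : R :=
  (1 + expR (pi * c)) / (1 + m * (1 + expR (pi * c))).

(** The kernel is [1 / (m + G0)] seen as a function of the Cauchy variable, so
    [ln (1 + l * wiener_kernel m c)] is the integrand of the Levy exponent. *)
Lemma wiener_kernelE c : wiener_kernel c = (m + logistic c)^-1.
Proof.
have E0 := expR_gt0 (pi * c); rewrite /wiener_kernel /logistic.
have E1 : 0 < 1 + expR (pi * c) by rewrite addr_gt0.
have E2 : 0 < 1 + m * (1 + expR (pi * c)) by rewrite addr_gt0// mulr_gt0.
move: (expR _) E0 E1 E2 => E E0 E1 E2; field.
by rewrite !gt_eqF// addrC.
Qed.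

Lemma wiener_kernel_bounds c : 0 <= wiener_kernel c <= m^-1.
Proof.
rewrite wiener_kernelE; have /andP[l0 _] := logistic01 c.
have ml : 0 < m + logistic c by rewrite addr_gt0.
by rewrite invr_ge0 (ltW ml)/= lef_pV2 ?posrE// lerDl ltW.
Qed.

Lemma continuous_cot (t : R) : 0 < t ->
  {in `]0, t[, continuous (fun u => cot (pi * u / t))}.
Proof.
move=> t0 u; rewrite in_itv/= => /andP[u0 ut].
have s0 : sin (pi * u / t) != 0.
  by rewrite gt_eqF// -mulrA sin_pi_gt0 ?divr_gt0// ltr_pdivrMr// mul1r.
have cu : {for u, continuous (fun u => pi * u / t)}.
  by apply: cvgMl; apply: cvgMr; exact: cvg_id.
apply: cvgM; first by apply: continuous_comp; [exact: cu|exact: continuous_cos].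
apply: cvgV => //.
by apply: continuous_comp; [exact: cu|exact: continuous_sin].
Qed.

Lemma continuous_wiener_kernel : continuous wiener_kernel.
Proof.
move=> c; have E0 := expR_gt0 (pi * c).
have cE : 1 + expR (pi * x) @[x --> c] --> 1 + expR (pi * c).
  by apply: cvgD; [exact: cvg_cst|exact: continuous_expRM].
apply: cvgM => //; apply: cvgV.
  by rewrite gt_eqF// addr_gt0// mulr_gt0// addr_gt0.
by apply: cvgD; [exact: cvg_cst|apply: cvgMr].
Qed.

End wiener_gamma_kernel.

(** * The subordinator Gamma: transform, density at time 1 and representation *)

Section Gamma_laplace.
Context {R : realType}.
Variables (m : R) (m0 : 0 < m).
Variables (dC : measure_display) (TC : measurableType dC) (PC : probability TC R).
Variables (C : {RV PC >-> R}) (C_cauchy : has_density C cauchy_pdf).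
Variables (dG : measure_display) (TG : measurableType dG) (PG : probability TG R).
Variables (G0 : {RV PG >-> R}).
Hypothesis G0_law : same_law PG G0 PC (fun w => 1 / (1 + expR (pi * C w))).
Variables (d : measure_display) (T : measurableType d) (P : probability T R).
Variable Gam : subordinator P.
Hypothesis Gam_laplace : has_levy_density Gam
  (fun x => (x^-1)%:E * 'E_PG[fun w => expR (- x * (m + G0 w))])%E.

Lemma ratio_gt0 l : 0 <= l -> 0 < ln (1 + 1 / (l + m)) / ln (1 + 1 / m).
Proof.
by move=> l0; rewrite divr_gt0// ln_gt0 ?ltrDl ?divr_gt0// ltr_wpDl.
Qed.

Lemma Gamma_laplaceE l t : 0 <= l -> 0 <= t ->
  (\int[P]_w (expR (- l * Gam t w))%:E =
   ((ln (1 + 1 / (l + m)) / ln (1 + 1 / m)) `^ t)%:E)%E.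
Proof.
move=> l0 t0; have := Gam_laplace l0 t0.
rewrite (levy_exponent_logistic G0_law)// (expectation_ln_logistic C_cauchy)//.
(* The sign in the Levy-Khintchine formula cancels that of the exponent; the base being positive,
   [powR] is [e^(t ln)] of it. *)
by rewrite unlock => ->; rewrite -EFinM -EFinN mulrN opprK /powR gt_eqF ?ratio_gt0.
Qed.

Lemma Gamma_ge0 t w : 0 <= t -> 0 <= Gam t w.
Proof. by move=> t0; rewrite -(sub_start Gam w) sub_nondecreasing. Qed.

Lemma Gamma1_density (A : set R) : measurable A ->
  P (Gam 1 @^-1` A) = (\int[lebesgue_measure]_(x in A) (Gamma1_pdf m x)%:E)%E.
Proof.
apply: density_laplace_law.
- exact: measurable_funPT.
- by move=> w; exact: Gamma_ge0.
- by move=> x; exact: Gamma1_pdf_ge0.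
- exact: measurable_Gamma1_pdf.
- by move=> x x0; rewrite Gamma1_pdf_le0// ltW.
- move=> n; rewrite Gamma1_pdf_laplace// Gamma_laplaceE//.
  by rewrite powRr1// ltW// ratio_gt0.
Qed.

(** The Stieltjes integral is extended-real but finite on every path, so the laws are first compared
    on the real line after [fine]. At integer arguments, the cotangent substitution turns the
    exponent of the integral into [t] times the expected logarithm under the Cauchy law. *)
Lemma Gamma_wiener_law (dg : measure_display) (Tg : measurableType dg)
    (Pg : probability Tg R) (gam : subordinator Pg) (t : R) :
  standard_gamma_process gam -> 0 < t ->
  same_law P (fun w => (Gam t w)%:E)
    Pg (stieltjes_integral gam (fun u => wiener_kernel m (cot (pi * u / t))) t).
Proof.
move=> gam_std t0; pose h u := wiener_kernel m (cot (pi * u / t)); rewrite -/h.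
set I := stieltjes_integral _ _ _.
have hM u : 0 <= h u <= m^-1 by exact: wiener_kernel_bounds.
have ch : {in `]0, t[, continuous h}.
  move=> u ut; apply: (@continuous_comp _ _ _ (fun u => cot (pi * u / t)) (wiener_kernel m)).
    exact: continuous_cot ut.
  exact: continuous_wiener_kernel.
have Ifin w : I w = (fine (I w))%:E.
  by rewrite fineK//; exact: stieltjes_integral_fin hM ch w.
have mI : measurable_fun setT I by exact: measurable_stieltjes_integral hM ch.
have mfI : measurable_fun setT (fun w => fine (I w)) by exact: measurableT_comp.
have mGam : measurable_fun setT (Gam t) by exact: measurable_funPT.
have law : forall A : set R, measurable A ->
    P (Gam t @^-1` A) = Pg ((fun w => fine (I w)) @^-1` A).
  apply: same_law_laplace => //.
  - by move=> w; exact: Gamma_ge0 (ltW t0).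
  - move=> w; apply: fine_ge0; apply: integral_ge0 => u _.
    by rewrite lee_fin; have /andP[] := hM u.
  - move=> n; rewrite (Gamma_laplaceE (ler0n _ n) (ltW t0)).
    rewrite (wiener_gamma_laplace gam_std t0 hM ch)//.
    have mk : measurable_fun setT (fun c => ln (1 + n%:R / (m + logistic c))).
      apply: measurableT_comp => //; apply: measurable_funD => //; apply: measurable_funM => //.
      apply: (measurableT_comp measurable_inv); apply: measurable_funD => //.
      exact: measurable_logistic.
    have k0 c : 0 <= ln (1 + n%:R / (m + logistic c)).
      by rewrite ln_ge0// lerDl divr_ge0// addr_ge0 ?(ltW m0)//; have /andP[/ltW] := logistic01 c.
    have -> : (\int[lebesgue_measure]_(u in `]0%R, t]) (ln (1 + n%:R * h u))%:E =
        \int[lebesgue_measure]_(u in `]0%R, t])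
          (ln (1 + n%:R / (m + logistic (cot (pi * u / t)))))%:E)%E.
      by apply: eq_integral => u _; rewrite /h wiener_kernelE.
    rewrite (integral_cot_cauchy C_cauchy t0 mk k0) (expectation_ln_logistic C_cauchy)//.
    by rewrite -EFinM -EFinN mulrN opprK /powR gt_eqF ?ratio_gt0.
split=> //; first exact/measurable_EFinP.
move=> A mA; rewrite (_ : I @^-1` A = (fun w => fine (I w)) @^-1` (EFin @^-1` A)); last first.
  by apply/seteqP; split => w; rewrite /preimage/= -Ifin.
rewrite -law//; rewrite -[X in measurable X]setTI.
have mE : measurable_fun setT (@EFin R) by apply/measurable_EFinP; exact: measurable_id.
exact: mE.
Qed.

End Gamma_laplace.

Theorem theorem3p6 (R : realType) (mu : R) (mu_gt0 : 0 < mu)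
  (dC : measure_display) (TC : measurableType dC) (PC : probability TC R)
  (C : {RV PC >-> R}) (C_cauchy : has_density C cauchy_pdf)
  (dG : measure_display) (TG : measurableType dG) (PG : probability TG R)
  (G0 : {RV PG >-> R})
  (G0_law : same_law PG G0 PC (fun w => 1 / (1 + expR (pi * C w))))
  (d : measure_display) (T : measurableType d) (P : probability T R)
  (Gam : subordinator P)
  (Gam_laplace : has_levy_density Gam
     (fun x => (x^-1)%:E * 'E_PG[fun w => expR (- x * (mu + G0 w))])%E) :
  [/\
    (forall lambda t : R, 0 <= lambda -> 0 <= t ->
       'E_P[fun w => expR (- lambda * Gam t w)]%E =
       ((ln (1 + 1 / (lambda + mu)) / ln (1 + 1 / mu)) `^ t)%:E),
    has_density (Gam 1)
      (fun x => 1 / ln (1 + 1 / mu) * expR (- mu * x)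
                * ((1 - expR (- x)) / x) * \1_(`[0, +oo[) x),
    (forall (dD : measure_display) (TD : measurableType dD)
       (PD : probability TD R) (D1 gamma1 : {RV PD >-> R}),
       has_density gamma1 (exponential_pdf 1) ->
       independent PD gamma1 D1 ->
       same_law P (Gam 1) PD (fun w => gamma1 w * D1 w) ->
       has_density D1
         (fun x => 1 / ln (1 + 1 / mu) * (1 / x)
                   * \1_(`[1 / (mu + 1), 1 / mu]) x)) &
    (forall (dg : measure_display) (Tg : measurableType dg)
       (Pg : probability Tg R) (gam : subordinator Pg),
       standard_gamma_process gam ->
       forall t : R, 0 < t ->
         same_law P (fun w => (Gam t w)%:E)
           Pg (stieltjes_integral gam
                 (fun u => (1 + expR (pi * cot (pi * u / t)))
                           / (1 + mu * (1 + expR (pi * cot (pi * u / t)))))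
                 t))].
Proof.
split.
- move=> l t l0 t0; rewrite unlock.
  exact: (Gamma_laplaceE mu_gt0 C_cauchy G0_law Gam_laplace).
- move=> A mA; exact: (Gamma1_density mu_gt0 C_cauchy G0_law Gam_laplace).
- move=> dD TD PD D1 gamma1 gamma1_exp ind [_ _ law].
  apply: (D1_has_density mu_gt0 gamma1_exp ind) => A mA.
  by rewrite -law// (Gamma1_density mu_gt0 C_cauchy G0_law Gam_laplace).
- move=> dg Tg Pg gam gam_std t t0.
  exact: (Gamma_wiener_law mu_gt0 C_cauchy G0_law Gam_laplace gam_std t0).
Qed.
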